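(* Suppose $d\neq 3$ (with $d$ an allowed loop parameter), and let $\omega\in\mathbb C^\times$ with $d=\omega+\omega^{-1}+1$. For $z\in\mathbb C$ let $$A(z)=\Big(-\frac{(1+\omega^2)(z+\omega^2)}{\omega^2(z+1)},\ 1,\ -\frac{(\omega-1)(z+\omega^2)}{\omega(\omega z-1)}\Big)\in Q_4,$$ $$B(z)=A\Big(\frac{z}{\omega^2}\Big),\qquad C(z)=\frac{z+\omega^4}{\omega(z+\omega^2)}\,A\Big(-\frac z\omega\Big),$$ the one-parameter solution of the ABC equation. Then $(A(z),B(z),C(z))$ scales provided $z\neq\pm\omega^n$ for any $n\in\mathbb Z$.
   Context: Allowed loop parameters: $d=4\cos^2(\pi/n)-1$ with $n=6,7,8,\dots$, or $d\in\mathbb R$, $d\ge3$. The planar algebra $\mathcal Q=(Q_n)$ (quantum $SO(3)$ in its 3-dimensional representation): $Q_n$ is the complex vector space spanned by planar trivalent graphs in a disc with $n$ boundary points, modulo the following local relations together with the radical of the sesquilinear form $\langle R,S\rangle$ obtained by gluing $R$ to the mirror image of $S$ and evaluating the resulting closed graph: a closed loop equals $d$; a vertex two of whose edges are joined to each other (lollipop) is $0$; a bigon equals a single strand (with two vertices removed); and $D-H=\frac1{d-1}(E-I)$, where, for a disc with boundary points $N,E,S,W$ in clockwise order, $H$ is the graph with two vertices joined by an edge, one attached to $N,W$ and the other to $E,S$; $D$ is the graph with two vertices joined by an edge, one attached to $N,E$ and the other to $S,W$; $I$ consists of arcs $N$–$E$ and $S$–$W$; $E$ (as a graph) consists of arcs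 $N$–$W$ and $E$–$S$. These relations evaluate every closed graph, and the form is positive definite on $Q_n$ for the allowed $d$. An element $pH+qI+rE$ of $Q_4$ is written $(p,q,r)$. Operations on $Q_4$: the product $XX'$ glues the boundary points $E,S$ of $X$ to $N,W$ of $X'$ respectively (unit $I$); the ''comultiplication'' $X.X'$ glues $N,E$ of $X$ to $W,S$ of $X'$ respectively (unit $E$), the resulting outer points being $N,E$ of $X'$ and $S,W$ of $X$. $X^{-1}$ and $X^\tau$ are the inverses for these two products. $\mathscr F$ is the rotation by $\pi/2$ for which the points $N,E,S,W$ of $\mathscr F(X)$ are $W,N,E,S$ of $X$; thus $\mathscr F(I)=E$, $\mathscr F(E)=I$, $\mathscr F(H)=D$, and $\mathscr F^2=\mathrm{id}$ on $Q_4$. Put $\alpha(X)=\mathscr F^{-1}(X^{-1})$ (domain: $X$ with $X^{-1}$ existing), $\beta(X)=\mathscr F(X^\tau)$ (domain: $X$ with $X^\tau$ existing); $\beta$ is the inverse of $\alpha$ and $\alpha^{-n}:=\beta^n$. The ABC equation is $\mathscr D(A,B)=\mathscr Y(C)$ in $Q_5$. The diagrams have five boundary points (bottom, left, top-left, top-right, right, clockwise). $\mathscr D(A,B)$: $E$ of $A$ is joined to $W$ of $B$; $S$ of $A$ and $S$ of $B$ are joined to two edges (left and right respectively) of a trivalent vertex whose third edge is the bottom point; the other boundary points are left $=W$ of $A$, top-left $=N$ of $A$, top-right $=N$ of $B$, right $=E$ of $B$. $\mathscr Y(C)$: $S,W,E$ of $C$ are the bottom, left and right points, and $N$ of $C$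 is joined to a trivalent vertex whose other two edges are the top-left and top-right points. $(A,B,C)$ ''scales'' if it satisfies the ABC equation and $A,B,C\in\mathrm{Dom}(\alpha^n)$ for all $n\in\mathbb Z$. *)

(* Defs.v *)
From HB Require Import structures.
From mathcomp Require Import all_boot all_order all_algebra.
From mathcomp Require Import complex finmap.
From mathcomp Require Import reals trigo.
From mathcomp.multinomials Require Import monalg.

Set Implicit Arguments.
Unset Strict Implicit.
Unset Printing Implicit Defensive.

Import Order.TTheory GRing.Theory Num.Theory.

Local Open Scope ring_scope.

Declare Scope skein_scope.
Delimit Scope skein_scope with skein.

(* A planar trivalent graph in a disc is drawn in general position in a       *)
(* rectangle and recorded as the word of its critical levels, read from       *)
(* bottom to top.  A level (g, i) is one of: a local minimum (Cup), a local   *)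
(* maximum (Cap), a vertex with two edges below and one above (Merge), a      *)
(* vertex with one edge below and two above (Split), where i is the number of *)
(* strands to its left.  The boundary points of the disc are the m end points *)
(* on the bottom side and the n end points on the top side.  Such a word is a *)
(* drawing; planar isotopy is imposed below, by the moves [isotopy].          *)

Inductive level_kind := Cup | Cap | Merge | Split.

Definition kind_code (g : level_kind) : bool * bool :=
  match g with
  | Cup => (false, false) | Cap => (false, true)
  | Merge => (true, false) | Split => (true, true)
  end.
Definition kind_decode (c : bool * bool) : level_kind :=
  match c with
  | (false, false) => Cup | (false, true) => Cap
  | (true, false) => Merge | (true, true) => Split
  end.
Lemma kind_codeK : cancel kind_code kind_decode. Proof. by case. Qed.
HB.instance Definition _ := Choice.copy level_kind (can_type kind_codeK).

Definition edges_below (g : level_kind) : nat :=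
  match g with Cup => 0 | Cap => 2 | Merge => 2 | Split => 1 end.
Definition edges_above (g : level_kind) : nat :=
  match g with Cup => 2 | Cap => 0 | Merge => 1 | Split => 2 end.
Definition flip (g : level_kind) : level_kind :=
  match g with Cup => Cap | Cap => Cup | Merge => Split | Split => Merge end.

Definition word := seq (level_kind * nat).

Fixpoint top_count (m : nat) (w : word) : option nat :=
  match w with
  | [::] => Some m
  | (g, i) :: w' =>
      if (i + edges_below g <= m)%N
      then top_count (m - edges_below g + edges_above g) w'
      else None
  end.

Definition typed (m n : nat) (w : word) : bool := top_count m w == Some n.

Definition shift_word (k : nat) (w : word) : word :=
  [seq (s.1, (k + s.2)%N) | s <- w].

Definition mirror_word (w : word) : word := rev [seq (flip s.1, s.2) | s <- w].

Definition nested_cups (m : nat) : word := [seq (Cup, i) | i <- iota 0 m].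

Lemma top_count_cat m u v :
  top_count m (u ++ v) = obind (top_count^~ v) (top_count m u).
Proof. by elim: u m => [|[g i] u IHu] m //=; case: ifP. Qed.

Lemma top_count_shift k m w :
  top_count (k + m) (shift_word k w) = omap (addn k) (top_count m w).
Proof.
elim: w m => [|[g i] w IHw] m //=.
rewrite -addnA leq_add2l; case: ifP => // le_m.
have le_g : (edges_below g <= m)%N by rewrite (leq_trans _ le_m) ?leq_addl.
by rewrite -IHw -addnBA // addnA.
Qed.

Lemma typed_widen k m n w : typed m n w -> typed (m + k) (n + k) w.
Proof.
rewrite /typed; elim: w m => [|[g i] w IHw] m /=.
  by move=> /eqP[->].
case: ifP => // le_m /IHw /eqP <-.
have le_g : (edges_below g <= m)%N by rewrite (leq_trans _ le_m) ?leq_addl.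
rewrite (leq_trans le_m) ?leq_addr //.
by rewrite -(addnBAC k le_g) (addnAC _ k).
Qed.

Lemma typed_cat m n p u v : typed m n u -> typed n p v -> typed m p (u ++ v).
Proof. by rewrite /typed top_count_cat => /eqP->. Qed.

Lemma typed_shift k m n w : typed m n w -> typed (k + m) (k + n) (shift_word k w).
Proof. by rewrite /typed top_count_shift => /eqP->. Qed.

Lemma typed_beside m n m' n' u v :
  typed m n u -> typed m' n' v -> typed (m + m') (n + n') (u ++ shift_word n v).
Proof. by move=> /(typed_widen m') Hu /(typed_shift n); apply: typed_cat. Qed.

Lemma typed_mirror m n w : typed m n w -> typed n m (mirror_word w).
Proof.
elim: w m => [|[g i] w IHw] m.
  by rewrite /typed /= => /eqP[->].
rewrite {1}/typed /=; case: ifP => // le_m /IHw {}IHw.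
rewrite /mirror_word /= rev_cons -cats1; apply: typed_cat IHw _.
rewrite /typed /=; have le_g : (edges_below g <= m)%N.
  by rewrite (leq_trans _ le_m) ?leq_addl.
have -> : edges_below (flip g) = edges_above g by case: g {le_m le_g}.
have -> : edges_above (flip g) = edges_below g by case: g {le_m le_g}.
by rewrite leq_add2r leq_subRL // addnC le_m addnK subnK.
Qed.

Lemma typed_nested_cups m : typed 0 (m + m) (nested_cups m).
Proof.
elim: m => // m IHm; rewrite /nested_cups -addn1 iotaD map_cat.
apply: typed_cat IHm _; rewrite /typed /= addn0 add0n leq_addr subn0.
by rewrite addnACA.
Qed.

Definition diagram (m n : nat) := {w : word | typed m n w}.

Definition strands (n : nat) : diagram n n := Sub (nil : word) (eqxx (Some n)).

Definition dstack m n p (f : diagram m n) (g : diagram n p) : diagram m p :=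
  Sub (val f ++ val g) (typed_cat (valP f) (valP g)).

Definition dbeside m n m' n' (f : diagram m n) (g : diagram m' n') :
    diagram (m + m') (n + n') :=
  Sub (val f ++ shift_word n (val g)) (typed_beside (valP f) (valP g)).

Definition dmirror m n (f : diagram m n) : diagram n m :=
  Sub (mirror_word (val f)) (typed_mirror (valP f)).

Definition dnest (m : nat) : diagram 0 (m + m) :=
  Sub (nested_cups m) (typed_nested_cups m).

Definition dcup : diagram 0 2 := Sub ([:: (Cup, 0)] : word) isT.
Definition dcap : diagram 2 0 := Sub ([:: (Cap, 0)] : word) isT.
Definition dmerge : diagram 2 1 := Sub ([:: (Merge, 0)] : word) isT.
Definition dsplit : diagram 1 2 := Sub ([:: (Split, 0)] : word) isT.

(* Generating moves of planar isotopy: exchange of the heights of two pieces  *)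
(* side by side, straightening of a bent strand, and turning a trivalent      *)
(* vertex.  They are applied inside larger graphs by [local_null] below.      *)
Inductive isotopy : forall m n, diagram m n -> diagram m n -> Prop :=
| iso_exchange m n m' n' (f : diagram m n) (g : diagram m' n') :
    isotopy (dstack (dbeside f (strands m')) (dbeside (strands n) g))
            (dstack (dbeside (strands m) g) (dbeside f (strands n')))
| iso_zigzag_left :
    isotopy (dstack (dbeside dcup (strands 1)) (dbeside (strands 1) dcap))
            (strands 1)
| iso_zigzag_right :
    isotopy (dstack (dbeside (strands 1) dcup) (dbeside dcap (strands 1)))
            (strands 1)
| iso_turn_left :
    isotopy (dstack (dbeside dcup (strands 1)) (dbeside (strands 1) dmerge))
            dsplit
| iso_turn_right :
    isotopy (dstack (dbeside (strands 1) dcup) (dbeside dmerge (strands 1)))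
            dsplit.

Section PlanarAlgebra.

Variable C : numClosedFieldType.

(* Formal linear combinations of graphs in the disc with m + n boundary       *)
(* points; elements of Q_(m + n) are represented by them, and equality in     *)
(* Q_(m + n) is the relation [Qeq] below.                                     *)
Definition comb (m n : nat) := {malg C[diagram m n]}.

Definition graph m n (f : diagram m n) : comb m n := << f >>.

Definition stack m n p (X : comb m n) (Y : comb n p) : comb m p :=
  \sum_(f <- msupp X) \sum_(g <- msupp Y)
    (X@_f * Y@_g) *: graph (dstack f g).

Definition beside m n m' n' (X : comb m n) (Y : comb m' n') :
    comb (m + m') (n + n') :=
  \sum_(f <- msupp X) \sum_(g <- msupp Y)
    (X@_f * Y@_g) *: graph (dbeside f g).

Definition mirror m n (X : comb m n) : comb n m :=
  \sum_(f <- msupp X) (X@_f)^* *: graph (dmirror f).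

Local Notation "X ;; Y" := (stack X Y)
  (at level 50, left associativity) : skein_scope.
Local Notation "X ** Y" := (beside X Y)
  (at level 40, left associativity) : skein_scope.
Local Open Scope skein_scope.

Definition ids (n : nat) : comb n n := graph (strands n).
Definition gcup : comb 0 2 := graph dcup.
Definition gcap : comb 2 0 := graph dcap.
Definition gmerge : comb 2 1 := graph dmerge.
Definition gsplit : comb 1 2 := graph dsplit.

(* In Q_4 = comb 2 2 the bottom points are W, S and the top points are N, E,  *)
(* from left to right; so N, E, S, W is the clockwise order.                  *)
Definition gH : comb 2 2 := (gsplit ** ids 1) ;; (ids 1 ** gmerge).
Definition gD : comb 2 2 := gmerge ;; gsplit.
Definition gI : comb 2 2 := gcap ;; gcup.
Definition gE : comb 2 2 := ids 2.

Definition vec (p q r : C) : comb 2 2 := p *: gH + q *: gI + r *: gE.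

Variable d : C.

Inductive skein : forall m n, comb m n -> comb m n -> Prop :=
| skein_isotopy m n (f g : diagram m n) :
    isotopy f g -> skein (graph f) (graph g)
| skein_loop : skein (gcup ;; gcap) (d *: ids 0)
| skein_lollipop : skein (gsplit ;; gcap) 0
| skein_bigon : skein (gsplit ;; gmerge) (ids 1)
| skein_DH : skein (gD - gH) ((d - 1)^-1 *: (gE - gI)).

(* The linear combinations that vanish by the local relations: the smallest   *)
(* family of subspaces that contains the relations and is closed under        *)
(* insertion into larger graphs.                                              *)
Inductive local_null : forall m n, comb m n -> Prop :=
| null_skein m n (X Y : comb m n) : skein X Y -> local_null (X - Y)
| null_add m n (X Y : comb m n) :
    local_null X -> local_null Y -> local_null (X + Y)
| null_scale m n (a : C) (X : comb m n) : local_null X -> local_null (a *: X)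
| null_below m n p (X : comb m n) (Y : comb n p) :
    local_null X -> local_null (X ;; Y)
| null_above m n p (X : comb m n) (Y : comb n p) :
    local_null Y -> local_null (X ;; Y)
| null_left m n m' n' (X : comb m n) (Y : comb m' n') :
    local_null X -> local_null (X ** Y)
| null_right m n m' n' (X : comb m n) (Y : comb m' n') :
    local_null Y -> local_null (X ** Y).

Definition evaluates (X : comb 0 0) (v : C) : Prop :=
  local_null (X - v *: ids 0).

(* X glued along the boundary circle to the mirror image of Y: the top sides  *)
(* are glued directly, the bottom sides through nested arcs.                  *)
Definition glue m n (X Y : comb m n) : comb 0 0 :=
  graph (dnest m) ;; ((X ;; mirror Y) ** ids m) ;; graph (dmirror (dnest m)).

Definition form_radical m n (X : comb m n) : Prop :=
  forall Y : comb m n, evaluates (glue X Y) 0.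

Definition Qeq m n (X Y : comb m n) : Prop :=
  exists L N : comb m n, [/\ local_null L, form_radical N & X - Y = L + N].

Definition mulQ (X Y : comb 2 2) : comb 2 2 :=
  (ids 1 ** gcup ** ids 1) ;; (X ** Y) ;; (ids 1 ** gcap ** ids 1).

Definition comulQ (X Y : comb 2 2) : comb 2 2 := X ;; Y.

(* N, E, S, W of [rotQ X] are W, N, E, S of X; [rotVQ] is the inverse.        *)
Definition rotQ (X : comb 2 2) : comb 2 2 :=
  (gcup ** ids 2) ;; (ids 1 ** X ** ids 1) ;; (ids 2 ** gcap).
Definition rotVQ (X : comb 2 2) : comb 2 2 :=
  (ids 2 ** gcup) ;; (ids 1 ** X ** ids 1) ;; (gcap ** ids 2).

Definition is_inv (X Y : comb 2 2) : Prop :=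
  Qeq (mulQ X Y) gI /\ Qeq (mulQ Y X) gI.
Definition is_coinv (X Y : comb 2 2) : Prop :=
  Qeq (comulQ X Y) gE /\ Qeq (comulQ Y X) gE.

(* The partial maps alpha and beta as relations, single-valued up to [Qeq]:   *)
(* [alpha X Y] says that X^-1 exists and Y = F^-1(X^-1), and [beta X Y] that  *)
(* X^tau exists and Y = F(X^tau).                                             *)
Definition alpha (X Y : comb 2 2) : Prop :=
  exists Z, is_inv X Z /\ Qeq Y (rotVQ Z).
Definition beta (X Y : comb 2 2) : Prop :=
  exists Z, is_coinv X Z /\ Qeq Y (rotQ Z).

Fixpoint iter_rel (f : comb 2 2 -> comb 2 2 -> Prop) (k : nat)
    (X Y : comb 2 2) : Prop :=
  match k with
  | 0 => Qeq X Y
  | k'.+1 => exists2 Z, f X Z & iter_rel f k' Z Y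
  end.

Definition alpha_pow (n : int) : comb 2 2 -> comb 2 2 -> Prop :=
  match n with
  | Posz k => iter_rel alpha k
  | Negz k => iter_rel beta k.+1
  end.

Definition in_dom_alpha_pow (n : int) (X : comb 2 2) : Prop :=
  exists Y, alpha_pow n X Y.

(* Q_5 = comb 3 2, with bottom points left, bottom, right and top points      *)
(* top-left, top-right.                                                       *)
Definition diagD (X Y : comb 2 2) : comb 3 2 :=
  (ids 1 ** gsplit ** ids 1) ;; (X ** ids 2) ;; (ids 1 ** Y ** ids 1)
  ;; (ids 2 ** gcap).

Definition diagY (Z : comb 2 2) : comb 3 2 :=
  (Z ** ids 1) ;; (ids 1 ** gcap) ;; gsplit.

Definition ABC_equation (X Y Z : comb 2 2) : Prop := Qeq (diagD X Y) (diagY Z).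

Definition scales (X Y Z : comb 2 2) : Prop :=
  ABC_equation X Y Z /\
  forall n : int, [/\ in_dom_alpha_pow n X, in_dom_alpha_pow n Y
                    & in_dom_alpha_pow n Z].

Definition solA (w z : C) : comb 2 2 :=
  vec (- ((1 + w ^+ 2) * (z + w ^+ 2)) / (w ^+ 2 * (z + 1)))
      1
      (- ((w - 1) * (z + w ^+ 2)) / (w * (w * z - 1))).

Definition solB (w z : C) : comb 2 2 := solA w (z / w ^+ 2).

Definition solC (w z : C) : comb 2 2 :=
  ((z + w ^+ 4) / (w * (z + w ^+ 2))) *: solA w (- z / w).

End PlanarAlgebra.

Definition allowed_parameter (R : realType) (d : R) : Prop :=
  (exists n : nat, (6 <= n)%N /\ d = 4 * cos (pi / n%:R) ^+ 2 - 1) \/ 3 <= d.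

(* Main.v *)
Require Import Defs.
From mathcomp Require Import all_boot all_order all_algebra.
From mathcomp Require Import complex.
From mathcomp Require Import reals.
From mathcomp Require Import finmap trigo.
From mathcomp.multinomials Require Import monalg.
From mathcomp Require Import ring lra zify.
From Stdlib Require Import Morphisms.
Import Defs.

Import Order.TTheory GRing.Theory Num.Theory.
Local Open Scope ring_scope.

Set Implicit Arguments.
Unset Strict Implicit.
Unset Printing Implicit Defensive.

(** The proof has two independent halves: a coordinate computation in the basis
    H, I, E of Q_4, which is a matter of rational functions of z and omega, and
    the diagrammatic calculus that justifies the coordinates.

    Algebra of Q_4.  For the product, H and E/d are orthogonal idempotents and I
    is the unit, so that (p, q, r) acts with the three eigenvalues q, q + p and
    q + d r, and is invertible when these are nonzero ([op_table_inverse]).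
    Rotation carries (H, I, E) to (D, E, I), on which the comultiplication has
    the same multiplication table; the relation D - H = (E - I)/(d - 1)
    converts coordinates on (D, E, I) to coordinates on (H, I, E).  Hence alpha
    and beta become explicit rational maps of coordinates ([alpha_vec],
    [beta_vec]).  On the family A(z) they act by
      alpha (c A(z)) = (s(z)/c) A(- z/omega^3),
      beta  (c A(z)) = (t(z)/c) A(- z omega^3),
    where s and t are quotients of products of factors that vanish only at
    plus or minus powers of omega ([alpha_sol], [beta_sol]).  The condition on z
    is preserved by z |-> - z omega^(+-3), so every iterate is defined; B(z) and
    C(z) are nonzero multiples of A at z/omega^2 and - z/omega.

    The ABC equation.  Sliding one edge of a tree with five leaves past another
    by the relation between D and H writes every D(X, Y) and Y(Z), for X, Y, Z
    among H, I, E, on one tree and the five pictures made of an arc and a vertex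
    ([diagD_vec], [diagY_vec]).  Comparing the six coefficients leaves six
    identities between rational functions.

    Diagrams.  A picture is a word of levels, and the only properties of words
    that matter are equalities modulo isotopy.  These are decided by a bounded
    search through the words obtained from a given one by exchanging the heights
    of two levels and by a few rules that straighten strands, turn vertices or
    remove bigons ([reachable]); the soundness of the search
    ([reachable_sound]) turns each entry of the tables into a computation.

    The denominators contain d - 1, which is positive since
    4 cos(x)^2 - 1 = 1 + 2 cos(2 x) and 2 pi/n < pi/2
    ([allowed_parameter_gt1]). *)

(** * Gluing as a bilinear operation *)

Section LinearExtension.
Variables (C : numClosedFieldType) (K : choiceType) (V : lmodType C).

Definition linext (L : K -> V) (X : {malg C[K]}) : V :=
  \sum_(f <- msupp X) X@_f *: L f.

Lemma linext_widen (L : K -> V) (X : {malg C[K]}) (s : {fset K}) :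
  (msupp X `<=` s)%fset -> linext L X = \sum_(f <- s) X@_f *: L f.
Proof.
move=> sXs; apply: big_fset_incl => // f _ /mcoeff_outdom ->.
by rewrite scale0r.
Qed.

Lemma linext_linear L : linear (linext L).
Proof.
move=> a X Y; set s := (msupp X `|` msupp Y)%fset.
have sX : (msupp X `<=` s)%fset by exact: fsubsetUl.
have sY : (msupp Y `<=` s)%fset by exact: fsubsetUr.
have sXY : (msupp (a *: X + Y) `<=` s)%fset.
  apply: fsubset_trans (msuppD_le _ _) _.
  by apply: fsetSU; exact: msuppZ_le.
rewrite (linext_widen L sX) (linext_widen L sY) (linext_widen L sXY).
rewrite scaler_sumr -big_split /=; apply: eq_bigr => f _.
by rewrite mcoeffD mcoeffZ scalerDl scalerA.
Qed.

Lemma linextU L f : linext L << f >> = L f.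
Proof.
by rewrite (linext_widen L msuppU_le) big_seq_fset1 mcoeffUU scale1r.
Qed.
End LinearExtension.

Section BilinearExtension.
Variables (C : numClosedFieldType) (K K' : choiceType) (V : lmodType C).
Variable L : K -> K' -> V.

Definition bilext (X : {malg C[K]}) (Y : {malg C[K']}) : V :=
  \sum_(f <- msupp X) \sum_(g <- msupp Y) (X@_f * Y@_g) *: L f g.

Lemma bilextEl X Y : bilext X Y = linext (fun f => linext (L f) Y) X.
Proof.
apply: eq_bigr => f _; rewrite /linext scaler_sumr.
by apply: eq_bigr => g _; rewrite scalerA.
Qed.

Lemma bilextEr X Y : bilext X Y = linext (fun g => linext (L^~ g) X) Y.
Proof.
rewrite /bilext exchange_big; apply: eq_bigr => g _; rewrite /linext scaler_sumr.
by apply: eq_bigr => f _; rewrite scalerA mulrC.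
Qed.

Lemma bilextUU f g : bilext << f >> << g >> = L f g.
Proof. by rewrite bilextEl !linextU. Qed.

Lemma bilext_linearl Y : linear (bilext^~ Y).
Proof. by move=> a X X'; rewrite !bilextEl linext_linear. Qed.

Lemma bilext_linearr X : linear (bilext X).
Proof. by move=> a Y Y'; rewrite !bilextEr linext_linear. Qed.
End BilinearExtension.

Section Words.
Variable C : numClosedFieldType.
Local Notation comb := (@comb C).

Lemma linear_morphisms (U V : lmodType C) (f : U -> V) : linear f ->
  [/\ f 0 = 0, {morph f : x y / x + y}, {morph f : x y / x - y}
    & forall a, {morph f : x / a *: x}].
Proof.
move=> lin_f; have f0 : f 0 = 0.
  by have := lin_f 1 0 0; rewrite !scale1r addr0 -{1}[f 0]addr0 => /addrI.
have fZ a : {morph f : x / a *: x}.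
  by move=> x; have := lin_f a x 0; rewrite f0 !addr0.
split=> // x y; first by have := lin_f 1 x y; rewrite !scale1r.
by rewrite ![_ - y]addrC -scaleN1r lin_f scaleN1r addrC.
Qed.

Section Bilinearity.
Variables m n p m' n' : nat.
Implicit Types (X : comb m n) (Y : comb n p) (Z : comb m' n').

Lemma stack_linearl Y : linear ((@stack C m n p)^~ Y).
Proof. exact: (bilext_linearl _ Y). Qed.
Lemma stack_linearr X : linear (@stack C m n p X).
Proof. exact: (bilext_linearr _ X). Qed.
Lemma beside_linearl Z : linear ((@beside C m n m' n')^~ Z).
Proof. exact: (bilext_linearl _ Z). Qed.
Lemma beside_linearr X : linear (@beside C m n m' n' X).
Proof. exact: (bilext_linearr _ X). Qed.

Lemma stackDl Y : {morph (@stack C m n p)^~ Y : X X' / X + X'}.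
Proof. by case: (linear_morphisms (stack_linearl Y)). Qed.
Lemma stackBl Y : {morph (@stack C m n p)^~ Y : X X' / X - X'}.
Proof. by case: (linear_morphisms (stack_linearl Y)). Qed.
Lemma stackZl Y a : {morph (@stack C m n p)^~ Y : X / a *: X}.
Proof. by case: (linear_morphisms (stack_linearl Y)). Qed.
Lemma stack0l Y : stack (0 : comb m n) Y = 0.
Proof. by case: (linear_morphisms (stack_linearl Y)). Qed.
Lemma stackDr X : {morph @stack C m n p X : Y Y' / Y + Y'}.
Proof. by case: (linear_morphisms (stack_linearr X)). Qed.
Lemma stackBr X : {morph @stack C m n p X : Y Y' / Y - Y'}.
Proof. by case: (linear_morphisms (stack_linearr X)). Qed.
Lemma stackZr X a : {morph @stack C m n p X : Y / a *: Y}.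
Proof. by case: (linear_morphisms (stack_linearr X)). Qed.
Lemma stack0r X : stack X (0 : comb n p) = 0.
Proof. by case: (linear_morphisms (stack_linearr X)). Qed.
Lemma besideDl Z : {morph (@beside C m n m' n')^~ Z : X X' / X + X'}.
Proof. by case: (linear_morphisms (beside_linearl Z)). Qed.
Lemma besideBl Z : {morph (@beside C m n m' n')^~ Z : X X' / X - X'}.
Proof. by case: (linear_morphisms (beside_linearl Z)). Qed.
Lemma besideZl Z a : {morph (@beside C m n m' n')^~ Z : X / a *: X}.
Proof. by case: (linear_morphisms (beside_linearl Z)). Qed.
Lemma beside0l Z : beside (0 : comb m n) Z = 0.
Proof. by case: (linear_morphisms (beside_linearl Z)). Qed.
Lemma besideDr X : {morph @beside C m n m' n' X : Z Z' / Z + Z'}.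
Proof. by case: (linear_morphisms (beside_linearr X)). Qed.
Lemma besideBr X : {morph @beside C m n m' n' X : Z Z' / Z - Z'}.
Proof. by case: (linear_morphisms (beside_linearr X)). Qed.
Lemma besideZr X a : {morph @beside C m n m' n' X : Z / a *: Z}.
Proof. by case: (linear_morphisms (beside_linearr X)). Qed.
Lemma beside0r X : beside X (0 : comb m' n') = 0.
Proof. by case: (linear_morphisms (beside_linearr X)). Qed.
End Bilinearity.

(** Indexing by bare words, with value 0 on ill-typed ones, lets words be cut,
    concatenated and compared without transporting proofs of typing. *)
Definition cword m n (w : word) : comb m n :=
  oapp (@graph C m n) 0 (insub w).

Lemma cwordE m n (f : diagram m n) : cword m n (val f) = graph C f.
Proof. by rewrite /cword valK. Qed.

Lemma cword_sub m n w (ty : typed m n w) :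
  cword m n w = graph C (Sub w ty : diagram m n).
Proof. by rewrite -cwordE. Qed.

Lemma stack_graph m n p (f : diagram m n) (g : diagram n p) :
  stack (graph C f) (graph C g) = graph C (dstack f g).
Proof. exact: (bilextUU (fun f g => graph C (dstack f g))). Qed.

Lemma beside_graph m n m' n' (f : diagram m n) (g : diagram m' n') :
  beside (graph C f) (graph C g) = graph C (dbeside f g).
Proof. exact: (bilextUU (fun f g => graph C (dbeside f g))). Qed.

Lemma stack_cword m n p u v : typed m n u -> typed n p v ->
  stack (cword m n u) (cword n p v) = cword m p (u ++ v).
Proof.
by move=> tu tv; rewrite (cword_sub tu) (cword_sub tv) stack_graph -cwordE.
Qed.

Lemma beside_cword m n m' n' u v : typed m n u -> typed m' n' v ->
  beside (cword m n u) (cword m' n' v) =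
  cword (m + m') (n + n') (u ++ shift_word n v).
Proof.
by move=> tu tv; rewrite (cword_sub tu) (cword_sub tv) beside_graph -cwordE.
Qed.

Lemma ids_cword n : ids C n = cword n n [::].
Proof. exact: (esym (cwordE (strands n))). Qed.

End Words.

(** * Equality modulo the local relations *)

Section SkeinEquivalence.
Variables (C : numClosedFieldType) (d : C).
Local Notation comb := (@comb C).
Local Notation cword := (@cword C).

Definition skein_eq m n (X Y : comb m n) : Prop := local_null d (X - Y).
Local Notation "X =~ Y" := (skein_eq X Y) (at level 70, no associativity).

(** No relation gives 0 directly: it is produced, in every type, by putting the
    relation for a closed loop beside the zero combination. *)
Lemma local_null0 m n : @local_null C d m n 0.
Proof.
have := @null_left C d 0 0 m n _ 0 (null_skein (skein_loop d)).
by rewrite beside0r.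
Qed.

#[export] Instance skein_eq_equiv m n : Equivalence (@skein_eq m n).
Proof.
split=> [X|X Y|X Y Z]; rewrite /skein_eq.
- by rewrite subrr; exact: local_null0.
- by move/(null_scale (-1)); rewrite scaleN1r opprB.
- by move=> /null_add XY /XY; rewrite addrA subrK.
Qed.

Lemma skein_eq_refl m n (X : comb m n) : X =~ X.
Proof. reflexivity. Qed.
#[local] Hint Resolve skein_eq_refl : core.

Lemma skein_eq_trans m n (X Y Z : comb m n) : X =~ Y -> Y =~ Z -> X =~ Z.
Proof. exact: transitivity. Qed.

#[export] Instance skein_eq_add m n :
  Proper (@skein_eq m n ==> @skein_eq m n ==> @skein_eq m n) +%R.
Proof.
move=> X X' eX Y Y' eY; rewrite /skein_eq opprD addrACA.
exact: null_add.
Qed.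

#[export] Instance skein_eq_opp m n :
  Proper (@skein_eq m n ==> @skein_eq m n) -%R.
Proof. by move=> X X' /(null_scale (-1)); rewrite scaleN1r opprD. Qed.

#[export] Instance skein_eq_scale m n :
  Proper (eq ==> @skein_eq m n ==> @skein_eq m n) *:%R.
Proof. by move=> a _ <- X X' eX; rewrite /skein_eq -scalerBr; exact: null_scale. Qed.

#[export] Instance skein_eq_stack m n p :
  Proper (@skein_eq m n ==> @skein_eq n p ==> @skein_eq m p) (@stack C m n p).
Proof.
move=> X X' eX Y Y' eY; transitivity (stack X' Y); rewrite /skein_eq.
  by rewrite -stackBl; exact: null_below.
by rewrite -stackBr; exact: null_above.
Qed.

#[export] Instance skein_eq_beside m n m' n' :
  Proper (@skein_eq m n ==> @skein_eq m' n' ==> @skein_eq (m + m') (n + n'))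
         (@beside C m n m' n').
Proof.
move=> X X' eX Y Y' eY; transitivity (beside X' Y); rewrite /skein_eq.
  by rewrite -besideBl; exact: null_left.
by rewrite -besideBr; exact: null_right.
Qed.

Lemma skein_eqE m n (X Y : comb m n) : skein d X Y -> X =~ Y.
Proof. exact: null_skein. Qed.

Lemma isotopy_eq m n (f g : diagram m n) :
  isotopy f g -> cword m n (val f) =~ cword m n (val g).
Proof. by rewrite !cwordE => /(@skein_isotopy C d)/skein_eqE. Qed.

Lemma Qeq_skein m n (X Y : comb m n) : X =~ Y -> Qeq d X Y.
Proof.
move=> eXY; exists (X - Y), 0; split; rewrite ?addr0 // => Z.
rewrite /evaluates /glue stack0l beside0l stack0r stack0l scale0r subr0.
exact: local_null0.
Qed.

(** * Deciding isotopies of words *)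

(** The typing is part of the conclusion because the rules need not preserve it
    backwards: a word may become typable on fewer strands once a zigzag has been
    removed from it. *)
Definition word_eq (u v : word) : Prop :=
  forall m n, typed m n u -> typed m n v /\ cword m n u =~ cword m n v.

Lemma word_eq_trans u v w : word_eq u v -> word_eq v w -> word_eq u w.
Proof.
move=> uv vw m n /uv[/vw[tw evw] euv]; split=> //.
by transitivity (cword m n v).
Qed.

Lemma typed_catP m n u v :
  reflect (exists2 p, typed m p u & typed p n v) (typed m n (u ++ v)).
Proof.
apply: (iffP idP) => [|[p]]; last exact: typed_cat.
rewrite /typed top_count_cat; case: top_count => [p|] //=.
by exists p.
Qed.

Lemma word_eq_cat a b u v : word_eq u v -> word_eq (a ++ u ++ b) (a ++ v ++ b).
Proof.
move=> uv m n /typed_catP[p ta /typed_catP[q tu tb]].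
have [tv euv] := uv _ _ tu; split; first exact: typed_cat ta (typed_cat tv tb).
have tub := typed_cat tu tb; have tvb := typed_cat tv tb.
rewrite -(stack_cword C ta tub) -(stack_cword C ta tvb).
by rewrite -(stack_cword C tu tb) -(stack_cword C tv tb) euv.
Qed.

Lemma cword_pad k r m n u : typed m n u ->
  cword (k + m + r) (k + n + r) (shift_word k u) =
  beside (beside (ids C k) (cword m n u)) (ids C r).
Proof.
have t0 p : typed p p [::] by exact: eqxx.
move=> tu; rewrite !ids_cword (beside_cword C (t0 k) tu).
by rewrite (beside_cword C (typed_shift k tu) (t0 r)) cats0.
Qed.

Lemma typed_fun m n n' u : typed m n u -> typed m n' u -> n = n'.
Proof. by rewrite /typed => /eqP-> /eqP[]. Qed.

(** Typing bounds m from below only by the strands that u meets, and u may meet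
    fewer than m0 of them; hence the hypothesis on the width. *)
Lemma typed_shift_inv k m0 n0 m n u :
    typed m0 n0 u -> (typed m n (shift_word k u) -> k + m0 <= m)%N ->
    typed m n (shift_word k u) ->
  exists2 r, m = (k + m0 + r)%N & n = (k + n0 + r)%N.
Proof.
move=> tu le_m tw; have {le_m} le_m := le_m tw.
exists (m - (k + m0))%N; first by rewrite subnKC.
apply: (typed_fun tw); rewrite -{1}(subnKC le_m).
exact/typed_widen/typed_shift.
Qed.

Lemma word_eq_shift k m0 n0 u v :
    typed m0 n0 u -> typed m0 n0 v -> cword m0 n0 u =~ cword m0 n0 v ->
    (forall m n, typed m n (shift_word k u) -> k + m0 <= m)%N ->
  word_eq (shift_word k u) (shift_word k v).
Proof.
move=> tu tv euv le_m m n tw.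
have [r -> ->] := typed_shift_inv tu (le_m m n) tw; split.
  exact/typed_widen/typed_shift.
by rewrite (cword_pad k r tu) (cword_pad k r tv) euv.
Qed.

(** The e strands between the two levels are absorbed into the right-hand
    picture, so that [iso_exchange] applies to neighbours. *)
Lemma word_eq_exchange g h i j : (i + edges_above g <= j)%N ->
  word_eq [:: (g, i); (h, j)]
          [:: (h, j - edges_above g + edges_below g)%N; (g, i)].
Proof.
move=> le_ij; set e := (j - (i + edges_above g))%N.
have tg g' : typed (edges_below g') (edges_above g') [:: (g', 0%N)].
  by case: g'.
pose f : diagram _ _ := Sub [:: (g, 0%N)] (tg g).
pose f' : diagram _ _ := Sub (shift_word e [:: (h, 0%N)]) (typed_shift e (tg h)).
have -> : [:: (g, i); (h, j)] =
    shift_word i (val (dstack (dbeside f (strands _)) (dbeside (strands _) f'))).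
  by rewrite /= !addn0; congr [:: _; (_, _)]; lia.
have -> : [:: (h, j - edges_above g + edges_below g)%N; (g, i)] =
    shift_word i (val (dstack (dbeside (strands _) f') (dbeside f (strands _)))).
  by rewrite /= !addn0; congr [:: (_, _); _]; lia.
apply: word_eq_shift; [exact: valP | exact: valP | | ].
  exact: (isotopy_eq (iso_exchange f f')).
move=> m n /=; rewrite !addn0 /typed /=.
by case: leqP => // le_g; case: leqP => // le_h _; lia.
Qed.

(** A rule is written at its leftmost position and may be used at every
    horizontal shift k. *)
Definition rule := (word * word)%type.
Definition sound (r : rule) : Prop :=
  forall k, word_eq (shift_word k r.1) (shift_word k r.2).

Definition all_sound (rules : seq rule) : Prop :=
  forall r, r \in rules -> sound r.

Definition exchanges (x y : level_kind * nat) : seq word :=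
  let: (g, i) := x in let: (h, j) := y in
  (if (i + edges_above g <= j)%N
   then [:: [:: (h, j - edges_above g + edges_below g)%N; x]] else [::]) ++
  (if (j + edges_below h <= i)%N
   then [:: [:: y; (g, i - edges_below h + edges_above h)%N]] else [::]).

(** Since the left-hand sides of the rules have two levels, the shift is read off
    the first one. *)
Definition apply_rule (x y : level_kind * nat) (r : rule) : seq word :=
  let k := (x.2 - (head x r.1).2)%N in
  if shift_word k r.1 == [:: x; y] then [:: shift_word k r.2] else [::].

Fixpoint one_step (rules : seq rule) (w : word) : seq word :=
  if w is x :: (y :: w') as w1 then
    [seq v ++ w' | v <- exchanges x y ++ flatten (map (apply_rule x y) rules)] ++
    [seq x :: v | v <- one_step rules w1]
  else [::].

(** Words already found are kept, and duplicates removed, so that the list stays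
    as short as the set of isotopic words. *)
Definition reachable (rules : seq rule) (steps : nat) (u : word) : seq word :=
  iter steps (fun s => undup (s ++ flatten (map (one_step rules) s))) [:: u].

(** The exchange from right to left is the inverse of an exchange from left to
    right, read at the target. *)
Lemma word_eq_exchange_back g h i j : (j + edges_below h <= i)%N ->
  word_eq [:: (g, i); (h, j)]
          [:: (h, j); (g, i - edges_below h + edges_above h)%N].
Proof.
move=> le_ji m n tw; move def_i: (i - edges_below h + edges_above h)%N => i'.
have tw' : typed m n [:: (h, j); (g, i')].
  move: tw; rewrite /typed /=; case: leqP => // le_i; case: leqP => // le_j e.
  case: leqP => [le_jm|lt_jm]; last by lia.
  case: leqP => [le_im|lt_im]; last by lia.
  by rewrite -(eqP e); apply/eqP; congr Some; lia.
split=> //; have le_ij : (j + edges_above h <= i')%N by lia.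
have [_ eq_w] := word_eq_exchange (g := h) (h := g) le_ij tw'.
have def_i2 : (i' - edges_above h + edges_below h)%N = i by lia.
by rewrite def_i2 in eq_w; symmetry.
Qed.

Lemma exchanges_sound x y v : v \in exchanges x y -> word_eq [:: x; y] v.
Proof.
case: x y => [g i] [h j]; rewrite mem_cat /= => /orP[].
  by case: ifP => // le_ij; rewrite mem_seq1 => /eqP->; exact: word_eq_exchange.
by case: ifP => // le_ji; rewrite mem_seq1 => /eqP->; exact: word_eq_exchange_back.
Qed.

Lemma one_step_sound rules u v : all_sound rules ->
  v \in one_step rules u -> word_eq u v.
Proof.
move=> ok; elim: u v => // x [|y w] IHw v //.
rewrite [one_step _ _]/= mem_cat => /orP[/mapP[s + ->]|/mapP[s /IHw eq_s ->]].
  rewrite mem_cat => eq_s; rewrite -[x :: y :: w]/([::] ++ [:: x; y] ++ w).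
  apply: (word_eq_cat (a := [::])); case/orP: eq_s => [/exchanges_sound //|].
  case/flatten_mapP=> r /ok eq_r; rewrite /apply_rule; case: ifP => // /eqP<-.
  by rewrite mem_seq1 => /eqP->; exact: eq_r.
by have := word_eq_cat (a := [:: x]) (b := [::]) eq_s; rewrite /= !cats0.
Qed.

Lemma reachable_sound rules steps u v : all_sound rules ->
  v \in reachable rules steps u -> word_eq u v.
Proof.
move=> ok; elim: steps v => [|k IHk] v /=; first by rewrite mem_seq1 => /eqP->.
rewrite mem_undup mem_cat => /orP[/IHk //|/flatten_mapP[w /IHk uw]].
by move/(one_step_sound ok)/(word_eq_trans uw).
Qed.

Lemma reachable_eq rules steps m n u v : all_sound rules ->
  v \in reachable rules steps u -> typed m n u -> cword m n u =~ cword m n v.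
Proof. by move=> ok /(reachable_sound ok) uv /uv[]. Qed.

Lemma generators_cword :
  [/\ gcup C = cword 0 2 [:: (Cup, 0%N)], gcap C = cword 2 0 [:: (Cap, 0%N)],
      gmerge C = cword 2 1 [:: (Merge, 0%N)] &
      gsplit C = cword 1 2 [:: (Split, 0%N)]].
Proof. by rewrite /gcup /gcap /gmerge /gsplit -!cwordE. Qed.

(** The defining moves, read in the direction that shortens the word, together
    with the relation that removes a bigon. *)
Definition straightening : seq rule :=
  [:: ([:: (Cup, 0); (Cap, 1)], [::]);
      ([:: (Cup, 1); (Cap, 0)], [::]);
      ([:: (Cup, 0); (Merge, 1)], [:: (Split, 0)]);
      ([:: (Cup, 1); (Merge, 0)], [:: (Split, 0)]);
      ([:: (Split, 0); (Merge, 0)], [::])]%N.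

Lemma sound_local m0 n0 u v : typed m0 n0 u -> typed m0 n0 v ->
  (forall k m n, typed m n (shift_word k u) -> k + m0 <= m)%N ->
  cword m0 n0 u =~ cword m0 n0 v -> sound (u, v).
Proof. by move=> tu tv le_m e k; apply: word_eq_shift tu tv e (le_m k). Qed.

Lemma sound_nil : all_sound [::].
Proof. by []. Qed.

Lemma sound_cons r rules : sound r -> all_sound rules ->
  all_sound (r :: rules).
Proof. by move=> sr srs r'; rewrite inE => /predU1P[-> //|/srs]. Qed.

(* Proves that an explicit word occupies all the strands of its picture. *)
Ltac widths := move=> ? ? ?; rewrite /typed /=;
  repeat (case: leqP => //= ?); lia.

Lemma straightening_sound : all_sound straightening.
Proof.
apply: sound_cons.
  apply: (sound_local (m0 := 1) (n0 := 1)) => //; first by widths.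
  exact: (isotopy_eq iso_zigzag_left).
apply: sound_cons.
  apply: (sound_local (m0 := 1) (n0 := 1)) => //; first by widths.
  exact: (isotopy_eq iso_zigzag_right).
apply: sound_cons.
  apply: (sound_local (m0 := 1) (n0 := 2)) => //; first by widths.
  exact: (isotopy_eq iso_turn_left).
apply: sound_cons.
  apply: (sound_local (m0 := 1) (n0 := 2)) => //; first by widths.
  exact: (isotopy_eq iso_turn_right).
apply: sound_cons.
  apply: (sound_local (m0 := 1) (n0 := 1)) => //; first by widths.
  have [_ _ eM eS] := generators_cword; have := skein_eqE (skein_bigon d).
  by rewrite eM eS stack_cword // ids_cword.
exact: sound_nil.
Qed.

(** The rules are one-directional, so two words with the same picture need not
    reach each other; it is enough that both are reached from a third one. *)
Lemma joinable rules steps w m n u v : all_sound rules ->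
    u \in reachable rules steps w -> v \in reachable rules steps w ->
    typed m n w ->
  cword m n u =~ cword m n v.
Proof.
move=> ok wu wv tw; transitivity (cword m n w); last exact: reachable_eq wv tw.
by symmetry; apply: reachable_eq wu tw.
Qed.

(** Capping an outer edge of a Split turns it back into a Merge: replace the Split
    by its expression through Cup and Merge, and straighten. *)
Definition capping : seq rule :=
  [:: ([:: (Split, 0); (Cap, 1)], [:: (Merge, 0)]),
      ([:: (Split, 1); (Cap, 0)], [:: (Merge, 0)])
   & straightening]%N.

Lemma capping_sound : all_sound capping.
Proof.
apply: sound_cons.
  apply: (sound_local (m0 := 2) (n0 := 1)) => //; first by widths.
  by apply: (joinable (steps := 2) (w := [:: (Cup, 1); (Merge, 0); (Cap, 1)]%N)
                      straightening_sound); vm_compute.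
apply: sound_cons.
  apply: (sound_local (m0 := 2) (n0 := 1)) => //; first by widths.
  by apply: (joinable (steps := 2) (w := [:: (Cup, 1); (Merge, 2); (Cap, 0)]%N)
                      straightening_sound); vm_compute.
exact: straightening_sound.
Qed.

(** The rotation invariance of the vertex: H may be drawn slanting either way,
    and the third edge of a vertex may be closed up on either side. *)
Definition turning : seq rule :=
  [:: ([:: (Split, 1); (Merge, 0)], [:: (Split, 0); (Merge, 1)]),
      ([:: (Merge, 0); (Cap, 0)], [:: (Merge, 1); (Cap, 0)]),
      ([:: (Cup, 0); (Split, 0)], [:: (Cup, 0); (Split, 1)])
   & capping]%N.

Lemma turning_sound : all_sound turning.
Proof.
apply: sound_cons.
  apply: (sound_local (m0 := 2) (n0 := 2)) => //; first by widths.
  by apply: (joinable (steps := 2) (w := [:: (Cup, 1); (Merge, 2); (Merge, 0)]%N)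
                      capping_sound); vm_compute.
apply: sound_cons.
  apply: (sound_local (m0 := 3) (n0 := 0)) => //; first by widths.
  by apply: (joinable (steps := 2) (w := [:: (Split, 1); (Cap, 0); (Cap, 0)]%N)
                      capping_sound); vm_compute.
apply: sound_cons.
  apply: (sound_local (m0 := 0) (n0 := 3)) => //; first by widths.
  by apply: (joinable (steps := 2) (w := [:: (Cup, 0); (Cup, 0); (Merge, 1)]%N)
                      capping_sound); vm_compute.
exact: capping_sound.
Qed.

Lemma isotopic steps w m n u v :
    u \in reachable turning steps w -> v \in reachable turning steps w ->
    typed m n w ->
  cword m n u =~ cword m n v.
Proof. exact: joinable turning_sound. Qed.

(** Exhibits a word inside a longer one as a picture glued into a fixed context,
    so that the relations whose two sides are not words can be used there. *)
Lemma cword_context m n a u b k m0 n0 :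
    typed m0 n0 u -> (forall m n, typed m n (shift_word k u) -> k + m0 <= m)%N ->
    typed m n (a ++ shift_word k u ++ b) ->
  exists r, [/\ typed m (k + m0 + r) a, typed (k + n0 + r) n b &
    cword m n (a ++ shift_word k u ++ b) =
    stack (cword m (k + m0 + r) a)
      (stack (beside (beside (ids C k) (cword m0 n0 u)) (ids C r))
             (cword (k + n0 + r) n b))].
Proof.
move=> tu le_m /typed_catP[p ta /typed_catP[q tw tb]].
have [r def_p def_q] := typed_shift_inv tu (le_m p q) tw.
subst p q; exists r; split=> //.
rewrite -cword_pad // (stack_cword C tw tb).
by rewrite (stack_cword C ta (typed_cat tw tb)).
Qed.

Lemma lollipop_word m n a b k :
  typed m n (a ++ [:: (Split, k); (Cap, k)] ++ b) ->
  cword m n (a ++ [:: (Split, k); (Cap, k)] ++ b) =~ 0.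
Proof.
have [_ eA _ eS] := generators_cword.
have -> : [:: (Split, k); (Cap, k)] = shift_word k [:: (Split, 0%N); (Cap, 0%N)].
  by rewrite /= !addn0.
move=> tw; have [||r [ta tb ->]] := cword_context (m0 := 1) (n0 := 0) _ _ tw.
- by [].
- by move: (k); widths.
have := skein_eqE (skein_lollipop d); rewrite eS eA stack_cword // => /= ->.
by rewrite beside0r beside0l stack0l stack0r.
Qed.

Lemma loop_word m n a b k :
  typed m n (a ++ [:: (Cup, k); (Cap, k)] ++ b) ->
  cword m n (a ++ [:: (Cup, k); (Cap, k)] ++ b) =~ d *: cword m n (a ++ b).
Proof.
have [eU eA _ _] := generators_cword.
have -> : [:: (Cup, k); (Cap, k)] = shift_word k [:: (Cup, 0%N); (Cap, 0%N)].
  by rewrite /= !addn0.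
move=> tw; have [||r [ta tb ->]] := cword_context (m0 := 0) (n0 := 0) _ _ tw.
- by [].
- by move: (k); widths.
have := skein_eqE (skein_loop d); rewrite eU eA stack_cword // => /= ->.
rewrite besideZr besideZl stackZl stackZr (ids_cword C 0).
have t0 j : typed j j [::] by exact: eqxx.
rewrite -(cword_pad k r (t0 0%N)).
have -> := stack_cword C (t0 (k + 0 + r)%N) tb.
by have -> := stack_cword C ta tb.
Qed.
End SkeinEquivalence.

#[local] Hint Resolve skein_eq_refl : core.

(** * Tables for the generators *)

Section Generators.
Variables (C : numClosedFieldType) (d : C).
Local Notation comb := (@comb C).
Local Notation cword := (@cword C).
Local Notation "X =~ Y" := (skein_eq d X Y) (at level 70, no associativity).

(** The common multiplication table of the product on (H, I, E) and of the
    comultiplication on (D, E, I). *)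
Record op_table (op : comb 2 2 -> comb 2 2 -> comb 2 2) (h i e : comb 2 2) : Prop :=
  OpTable {
    op_hh : op h h =~ h; op_hi : op h i =~ h; op_ih : op i h =~ h;
    op_ii : op i i =~ i; op_ie : op i e =~ e; op_ei : op e i =~ e;
    op_he : op h e =~ 0; op_eh : op e h =~ 0; op_ee : op e e =~ d *: e }.

Definition dH : diagram 2 2 :=
  dstack (dbeside dsplit (strands 1)) (dbeside (strands 1) dmerge).
Definition dD : diagram 2 2 := dstack dmerge dsplit.
Definition dI : diagram 2 2 := dstack dcap dcup.
Definition dE : diagram 2 2 := strands 2.

Definition dmul (f g : diagram 2 2) : diagram 2 2 :=
  dstack (dstack (dbeside (dbeside (strands 1) dcup) (strands 1)) (dbeside f g))
         (dbeside (dbeside (strands 1) dcap) (strands 1)).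
Definition drot (f : diagram 2 2) : diagram 2 2 :=
  dstack (dstack (dbeside dcup (strands 2))
                 (dbeside (dbeside (strands 1) f) (strands 1)))
         (dbeside (strands 2) dcap).
Definition drotV (f : diagram 2 2) : diagram 2 2 :=
  dstack (dstack (dbeside (strands 2) dcup)
                 (dbeside (dbeside (strands 1) f) (strands 1)))
         (dbeside dcap (strands 2)).
Definition ddiagD (f g : diagram 2 2) : diagram 3 2 :=
  dstack (dstack (dstack (dbeside (dbeside (strands 1) dsplit) (strands 1))
                         (dbeside f (strands 2)))
                 (dbeside (dbeside (strands 1) g) (strands 1)))
         (dbeside (strands 2) dcap).
Definition ddiagY (f : diagram 2 2) : diagram 3 2 :=
  dstack (dstack (dbeside f (strands 1)) (dbeside (strands 1) dcap)) dsplit.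
(** The left and top-left points meet in a vertex, whose third edge enters the
    disc filled by f: for f equal to H and D, these are the two trees that
    contain this vertex. *)
Definition ddiagT (f : diagram 2 2) : diagram 3 2 :=
  dstack (dstack (dbeside dsplit (strands 2))
                 (dbeside (dbeside (strands 1) f) (strands 1)))
         (dbeside (strands 2) dcap).
Definition diagT (X : comb 2 2) : comb 3 2 :=
  stack (stack (beside (gsplit C) (ids C 2))
               (beside (beside (ids C 1) X) (ids C 1)))
        (beside (ids C 2) (gcap C)).

(** Relates an expression in the skein to its picture.  The picture is computed
    by resolution with the lemmas below, operation by operation. *)
Definition draws m n (f : diagram m n) (X : comb m n) : Prop := X = graph C f.

Lemma draws_H : draws dH (gH C).
Proof. by rewrite /draws /gH !beside_graph stack_graph. Qed.
Lemma draws_D : draws dD (gD C). Proof. exact: stack_graph. Qed.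
Lemma draws_I : draws dI (gI C). Proof. exact: stack_graph. Qed.
Lemma draws_E : draws dE (gE C). Proof. by []. Qed.

Lemma draws_mulQ f g X Y :
  draws f X -> draws g Y -> draws (dmul f g) (mulQ X Y).
Proof. by rewrite /draws => -> ->; rewrite /mulQ !(beside_graph, stack_graph). Qed.
Lemma draws_comulQ f g X Y :
  draws f X -> draws g Y -> draws (dstack f g) (comulQ X Y).
Proof. by rewrite /draws => -> ->; rewrite /comulQ stack_graph. Qed.
Lemma draws_rotQ f X : draws f X -> draws (drot f) (rotQ X).
Proof. by rewrite /draws => ->; rewrite /rotQ !(beside_graph, stack_graph). Qed.
Lemma draws_rotVQ f X : draws f X -> draws (drotV f) (rotVQ X).
Proof. by rewrite /draws => ->; rewrite /rotVQ !(beside_graph, stack_graph). Qed.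
Lemma draws_diagD f g X Y :
  draws f X -> draws g Y -> draws (ddiagD f g) (diagD X Y).
Proof. by rewrite /draws => -> ->; rewrite /diagD !(beside_graph, stack_graph). Qed.
Lemma draws_diagY f X : draws f X -> draws (ddiagY f) (diagY X).
Proof. by rewrite /draws => ->; rewrite /diagY !(beside_graph, stack_graph). Qed.
Lemma draws_diagT f X : draws f X -> draws (ddiagT f) (diagT X).
Proof. by rewrite /draws => ->; rewrite /diagT !(beside_graph, stack_graph). Qed.

Create HintDb drawing discriminated.
Hint Constants Opaque : drawing.
Hint Resolve draws_H draws_D draws_I draws_E draws_mulQ draws_comulQ
  draws_rotQ draws_rotVQ draws_diagD draws_diagY draws_diagT : drawing.

(** Both sides are reduced to a common word w, their normal form. *)
Lemma isotopic_draws steps w m n (f g : diagram m n) X Y :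
    draws f X -> draws g Y ->
    w \in reachable turning steps (val f) -> w \in reachable turning steps (val g) ->
  X =~ Y.
Proof.
move=> -> -> fw gw; rewrite -!cwordE; transitivity (cword m n w).
  exact: (reachable_eq (@turning_sound _ _) fw (valP f)).
by symmetry; exact: (reachable_eq (@turning_sound _ _) gw (valP g)).
Qed.

(** Both f and a word that contains a lollipop are reached from w. *)
Lemma lollipop_draws steps w a b k m n (f : diagram m n) X :
    draws f X -> typed m n w ->
    a ++ [:: (Split, k); (Cap, k)] ++ b \in reachable turning steps w ->
    val f \in reachable turning steps w ->
  X =~ 0.
Proof.
move=> -> tw lw fw; have [tl _] := reachable_sound (@turning_sound C d) lw tw.
rewrite -cwordE; transitivity (cword m n (a ++ [:: (Split, k); (Cap, k)] ++ b)).
  exact: isotopic fw lw tw.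
exact: lollipop_word.
Qed.

Lemma loop_draws a b k m n (f g : diagram m n) X Y :
    draws f X -> draws g Y -> val f = a ++ [:: (Cup, k); (Cap, k)] ++ b ->
    val g = a ++ b ->
  X =~ d *: Y.
Proof.
move=> -> -> def_f def_g; have := valP f; rewrite -!cwordE def_f def_g.
exact: loop_word.
Qed.

(* Six rounds of rewriting suffice for all the pictures below. *)
Ltac isotopy w :=
  refine (isotopic_draws (steps := 6%N) (w := w%N) _ _ _ _);
  [ solve [eauto with drawing] | solve [eauto with drawing]
  | vm_compute; reflexivity | vm_compute; reflexivity].
Ltac lollipop w a k b :=
  refine (lollipop_draws (steps := 3%N) (w := w%N) (a := a%N) (k := k%N)
            (b := b%N) _ _ _ _);
  [ solve [eauto with drawing] | vm_compute; reflexivity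
  | vm_compute; reflexivity | vm_compute; reflexivity].

Local Open Scope nat_scope.

Definition wH : word := [:: (Split, 0); (Merge, 1)].
Definition wD : word := [:: (Merge, 0); (Split, 0)].
Definition wI : word := [:: (Cap, 0); (Cup, 0)].
Definition wE : word := [::].

Lemma mulQ_table : op_table (@mulQ C) (gH C) (gI C) (gE C).
Proof.
split.
- isotopy wH.
- isotopy wH.
- isotopy wH.
- isotopy wI.
- isotopy wE.
- isotopy wE.
- lollipop (val (dmul dH dE)) [:: (Split, 0)] 1 wE.
(* The product of E and H shows a Cup closed by a Merge; turning the vertex at
   the Cup in the other direction gives a lollipop. *)
- lollipop [:: (Cup, 1); (Split, 1); (Merge, 3); (Cap, 1)]
           [:: (Cup, 1)] 1 [:: (Merge, 1)].
- by apply: (loop_draws (a := [::]) (k := 1) (b := [::])); eauto with drawing.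
Qed.

Lemma comulQ_table : op_table (@comulQ C) (gD C) (gE C) (gI C).
Proof.
split.
- isotopy wD.
- isotopy wD.
- isotopy wD.
- isotopy wE.
- isotopy wI.
- isotopy wI.
- lollipop (wD ++ wI) [:: (Merge, 0)] 0 [:: (Cup, 0)].
- lollipop [:: (Cap, 0); (Cup, 0); (Split, 0); (Cap, 0); (Split, 0)]
           wI 0 [:: (Split, 0)].
- by apply: (loop_draws (a := [:: (Cap, 0)]) (k := 0) (b := [:: (Cup, 0)]));
    eauto with drawing.
Qed.

Lemma rotQ_D : rotQ (gD C) =~ gH C. Proof. isotopy wH. Qed.
Lemma rotQ_I : rotQ (gI C) =~ gE C. Proof. isotopy wE. Qed.
Lemma rotQ_E : rotQ (gE C) =~ gI C. Proof. isotopy wI. Qed.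
Lemma rotVQ_H : rotVQ (gH C) =~ gD C. Proof. isotopy wD. Qed.
Lemma rotVQ_I : rotVQ (gI C) =~ gE C. Proof. isotopy wE. Qed.
Lemma rotVQ_E : rotVQ (gE C) =~ gI C. Proof. isotopy wI. Qed.

(** Pictures with five boundary points.  A bigon is removed in the entries
    (E, D) and (H, I), a lollipop appears in (E, I), and (D, E), (I, H) are
    trees. *)
Lemma diagD_ED : diagD (gE C) (gD C) =~ diagD (gE C) (gE C).
Proof. isotopy [:: (Merge, 1)]. Qed.
Lemma diagD_EI : diagD (gE C) (gI C) =~ 0%R.
Proof. lollipop (val (ddiagD dE dI)) wE 1 [:: (Cup, 1); (Cap, 2)]. Qed.
Lemma diagD_HI : diagD (gH C) (gI C) =~ diagD (gI C) (gI C).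
Proof. isotopy [:: (Merge, 0)]. Qed.
Lemma diagD_DE : diagD (gD C) (gE C) =~ diagY (gH C).
Proof. isotopy [:: (Merge, 1); (Merge, 0); (Split, 0)]. Qed.
Lemma diagD_IH : diagD (gI C) (gH C) =~ diagY (gD C).
Proof. isotopy [:: (Merge, 0); (Merge, 0); (Split, 0)]. Qed.
(** The triangular face is moved into a single disc, where it is bounded by H
    and D and can be evaluated in Q_4. *)
Lemma diagD_HD : diagD (gH C) (gD C) =~ diagT (comulQ (gH C) (gD C)).
Proof. isotopy [:: (Split, 0); (Split, 1); (Merge, 2); (Merge, 1); (Merge, 1)]. Qed.
Lemma diagT_H : diagT (gH C) =~ diagD (gH C) (gE C).
Proof. isotopy [:: (Split, 0); (Merge, 2); (Merge, 1)]. Qed.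
Lemma diagT_E : diagT (gE C) =~ diagY (gE C).
Proof. isotopy [:: (Cap, 1); (Split, 0)]. Qed.
Lemma diagT_I : diagT (gI C) =~ diagD (gI C) (gI C).
Proof. isotopy [:: (Merge, 0)]. Qed.
End Generators.

(** * Coordinates on three generators *)

Section Coordinates.
Variables (C : numClosedFieldType) (d : C).
Local Notation comb := (@comb C).
Local Notation "X =~ Y" := (skein_eq d X Y) (at level 70, no associativity).

Definition comb3 (V : lmodType C) (h i e : V) (p q r : C) : V :=
  p *: h + q *: i + r *: e.

Lemma comb3D (V : lmodType C) (h i e : V) p q r p' q' r' :
  comb3 h i e p q r + comb3 h i e p' q' r' =
  comb3 h i e (p + p') (q + q') (r + r').
Proof. by rewrite /comb3 !scalerDl addrACA (addrACA (p *: h)). Qed.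

Lemma comb3Z (V : lmodType C) (h i e : V) a p q r :
  a *: comb3 h i e p q r = comb3 h i e (a * p) (a * q) (a * r).
Proof. by rewrite /comb3 !scalerDr !scalerA. Qed.

Lemma comb3_basis (V : lmodType C) (h i e : V) :
  [/\ h = comb3 h i e 1 0 0, i = comb3 h i e 0 1 0,
      e = comb3 h i e 0 0 1 & 0 = comb3 h i e 0 0 0].
Proof. by rewrite /comb3 !scale1r !scale0r !addr0 !add0r. Qed.

(** Everything that follows is linear algebra: it is carried out in an arbitrary
    module, where the terms stay small, and then specialised to the skein. *)
Lemma comb3_linear (U V : lmodType C) (f : U -> V) h i e p q r : linear f ->
  f (comb3 h i e p q r) = comb3 (f h) (f i) (f e) p q r.
Proof. by case/linear_morphisms=> _ fD _ fZ; rewrite /comb3 !fD !fZ. Qed.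

Definition bilinear_op m n (op : comb 2 2 -> comb 2 2 -> comb m n) : Prop :=
  (forall Y, linear (op^~ Y)) /\ (forall X, linear (op X)).

Lemma mulQ_bilinear : bilinear_op (@mulQ C).
Proof.
split=> [Y|X] a Z Z'; rewrite /mulQ.
  by rewrite besideDl besideZl stackDr stackZr stackDl stackZl.
by rewrite besideDr besideZr stackDr stackZr stackDl stackZl.
Qed.

Lemma comulQ_bilinear : bilinear_op (@comulQ C).
Proof. by split=> [Y|X]; [exact: stack_linearl | exact: stack_linearr]. Qed.

Lemma diagD_bilinear : bilinear_op (@diagD C).
Proof.
split=> [Y|X] a Z Z'; rewrite /diagD.
  by rewrite besideDl besideZl stackDr stackZr !stackDl !stackZl.
by rewrite besideDr besideZr besideDl besideZl stackDr stackZr !stackDl !stackZl.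
Qed.

Lemma diagY_linear : linear (@diagY C).
Proof. by move=> a Z Z'; rewrite /diagY besideDl besideZl !stackDl !stackZl. Qed.

Lemma diagT_linear : linear (@diagT C).
Proof.
move=> a Z Z'; rewrite /diagT besideDr besideZr besideDl besideZl.
by rewrite stackDr stackZr !stackDl !stackZl.
Qed.

Lemma rotQ_linear : linear (@rotQ C).
Proof.
move=> a Z Z'; rewrite /rotQ besideDr besideZr besideDl besideZl.
by rewrite stackDr stackZr !stackDl !stackZl.
Qed.

Lemma rotVQ_linear : linear (@rotVQ C).
Proof.
move=> a Z Z'; rewrite /rotVQ besideDr besideZr besideDl besideZl.
by rewrite stackDr stackZr !stackDl !stackZl.
Qed.

Lemma comb3_bilinear m n (op : comb 2 2 -> comb 2 2 -> comb m n) h i e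
    p q r p' q' r' :
  bilinear_op op ->
  op (comb3 h i e p q r) (comb3 h i e p' q' r') =
  comb3 (comb3 (op h h) (op h i) (op h e) p' q' r')
        (comb3 (op i h) (op i i) (op i e) p' q' r')
        (comb3 (op e h) (op e i) (op e e) p' q' r') p q r.
Proof.
case=> opl opr; have linr X := comb3_linear h i e p' q' r' (opr X).
apply: etrans (comb3_linear h i e p q r (opl _)) _.
rewrite (linr h).
rewrite (linr i).
rewrite (linr e).
reflexivity.
Qed.

Lemma comb3_eq m n (h h' i i' e e' : comb m n) p q r :
  h =~ h' -> i =~ i' -> e =~ e' -> comb3 h i e p q r =~ comb3 h' i' e' p q r.
Proof. by move=> eh ei ee; rewrite /comb3 eh ei ee. Qed.

Lemma comb3_flatten (V : lmodType C) (h i e : V) p q r p' q' r' :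
  comb3 (comb3 h h 0 p' q' r') (comb3 h i e p' q' r')
        (comb3 0 e (d *: e) p' q' r') p q r =
  comb3 h i e (p * p' + p * q' + q * p') (q * q')
              (d * (r * r') + q * r' + r * q').
Proof.
have -> : comb3 h h 0 p' q' r' = comb3 h i e (p' + q') 0 0.
  by rewrite /comb3 scaler0 !scale0r !addr0 scalerDl.
have -> : comb3 0 e (d *: e) p' q' r' = comb3 h i e 0 0 (q' + r' * d).
  by rewrite /comb3 scaler0 !scale0r !add0r scalerDl scalerA.
rewrite [LHS]/(comb3 _ _ _ _ _ _) !comb3Z !comb3D.
by congr comb3; ring.
Qed.

Lemma op_table_mul op h i e p q r p' q' r' :
    bilinear_op op -> op_table d op h i e ->
  op (comb3 h i e p q r) (comb3 h i e p' q' r') =~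
  comb3 h i e (p * p' + p * q' + q * p') (q * q')
              (d * (r * r') + q * r' + r * q').
Proof.
move=> lin_op [hh hi ih ii ie ei he eh ee].
rewrite (comb3_bilinear h i e p q r p' q' r' lin_op) -comb3_flatten.
exact: comb3_eq (comb3_eq _ _ _ hh hi he) (comb3_eq _ _ _ ih ii ie)
                (comb3_eq _ _ _ eh ei ee).
Qed.

(** On h, on e and on the complement of both, (p, q, r) acts by the scalars
    q + p, q + d r and q; the coordinates of the inverse are found by inverting
    the scalars. *)
Lemma op_table_inverse op h i e p q r : bilinear_op op -> op_table d op h i e ->
    q != 0 -> q + p != 0 -> q + d * r != 0 ->
  let X := comb3 h i e p q r in
  let Y := comb3 h i e (- p / (q * (q + p))) q^-1 (- r / (q * (q + d * r))) in
  op X Y =~ i /\ op Y X =~ i.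
Proof.
move=> lin_op tab q0 qp0 qr0 X Y.
have [_ e1 _ _] := comb3_basis h i e.
have XY := op_table_mul p q r (- p / (q * (q + p))) q^-1 (- r / (q * (q + d * r)))
             lin_op tab.
have YX := op_table_mul (- p / (q * (q + p))) q^-1 (- r / (q * (q + d * r))) p q r
             lin_op tab.
have coords x y z : x = 0 -> y = 1 -> z = 0 -> comb3 h i e x y z = i.
  move=> -> -> ->; exact: esym e1.
split; [apply: skein_eq_trans XY _ | apply: skein_eq_trans YX _];
  rewrite coords; first [reflexivity | by field; rewrite ?q0 ?qp0 ?qr0].
Qed.
End Coordinates.

(** * Rotation and change of basis *)

Section Rotation.
Variables (C : numClosedFieldType) (d : C).
Local Notation comb := (@comb C).
Local Notation "X =~ Y" := (skein_eq d X Y) (at level 70, no associativity).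
Lemma comulQ_eq (X X' Y Y' : comb 2 2) :
  X =~ X' -> Y =~ Y' -> comulQ X Y =~ comulQ X' Y'.
Proof. by move=> eX eY; rewrite /comulQ eX eY. Qed.

Lemma strand_beside_eq (X X' : comb 2 2) : X =~ X' ->
  beside (beside (ids C 1) X) (ids C 1) =~ beside (beside (ids C 1) X') (ids C 1).
Proof.
move=> eX; exact: (skein_eq_beside (skein_eq_beside (skein_eq_refl d (ids C 1)) eX)
                                   (skein_eq_refl d (ids C 1))).
Qed.

(** The basis is the image of (H, I, E) under the rotation. *)
Definition vecD (p q r : C) : comb 2 2 := comb3 (gD C) (gE C) (gI C) p q r.

Local Notation k := (d - 1)^-1.

Lemma gD_turn : gD C =~ comb3 (gH C) (gE C) (gI C) 1 k (- k).
Proof.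
have eDH : gD C - gH C =~ k *: (gE C - gI C) by exact: skein_eqE (skein_DH d).
have -> : gD C = gH C + (gD C - gH C) by rewrite addrC subrK.
rewrite eDH /comb3 scale1r scalerBr scaleNr addrA; reflexivity.
Qed.

Lemma gH_turn : gH C =~ comb3 (gD C) (gE C) (gI C) 1 (- k) k.
Proof.
have eDH : gD C - gH C =~ k *: (gE C - gI C) by exact: skein_eqE (skein_DH d).
have -> : gH C = gD C - (gD C - gH C) by rewrite subKr.
rewrite eDH /comb3 scale1r scalerBr scaleNr opprB addrA addrAC; reflexivity.
Qed.

Lemma comb3_comp (V : lmodType C) (h i e : V) a1 a2 a3 b1 b2 b3 c1 c2 c3 p q r :
  comb3 (comb3 h i e a1 a2 a3) (comb3 h i e b1 b2 b3) (comb3 h i e c1 c2 c3) p q r =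
  comb3 h i e (p * a1 + q * b1 + r * c1) (p * a2 + q * b2 + r * c2)
              (p * a3 + q * b3 + r * c3).
Proof. by rewrite [LHS]/(comb3 _ _ _ _ _ _) !comb3Z !comb3D. Qed.

Lemma comb3_turn (V : lmodType C) (h i e : V) a b p q r :
  comb3 (comb3 h i e 1 a b) e i p q r = comb3 h i e p (r + a * p) (q + b * p).
Proof.
have [_ ei ee _] := comb3_basis h i e.
rewrite [X in comb3 _ X]ee [X in comb3 _ _ X]ei comb3_comp.
by congr comb3; ring.
Qed.

Lemma vec_vecD p q r : vec p q r =~ vecD p (r - k * p) (q + k * p).
Proof.
rewrite -mulNr /vecD -comb3_turn.
exact: comb3_eq gH_turn (skein_eq_refl d _) (skein_eq_refl d _).
Qed.

Lemma rotQ_vecD p q r : rotQ (vecD p q r) =~ vec p q r.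
Proof.
rewrite (comb3_linear _ _ _ _ _ _ (@rotQ_linear C)).
exact: comb3_eq (rotQ_D d) (rotQ_E d) (rotQ_I d).
Qed.

Lemma rotVQ_vec p q r : rotVQ (vec p q r) =~ vecD p q r.
Proof.
have := comb3_linear (gH C) (gI C) (gE C) p q r (@rotVQ_linear C) => /= ->.
exact: comb3_eq (rotVQ_H d) (rotVQ_I d) (rotVQ_E d).
Qed.
End Rotation.

(** * The orbit of A(z) under alpha and beta *)

Section Orbit.
Variables (C : numClosedFieldType) (d : C).
Local Notation comb := (@comb C).
Local Notation "X =~ Y" := (skein_eq d X Y) (at level 70, no associativity).
Local Notation k := (d - 1)^-1.

(** Invert on (H, I, E), rotate to (D, E, I), and return to (H, I, E). *)
Lemma alpha_vec p q r a b c (p' := - p / (q * (q + p)))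
    (r' := - r / (q * (q + d * r))) :
    q != 0 -> q + p != 0 -> q + d * r != 0 ->
    a = p' -> b = r' - k * p' -> c = q^-1 + k * p' ->
  alpha d (vec p q r) (vec a b c).
Proof.
move=> q0 qp0 qr0 -> -> ->; exists (vec p' q^-1 r').
have [XY YX] := op_table_inverse (@mulQ_bilinear C) (mulQ_table d) q0 qp0 qr0.
split; first by split; apply: Qeq_skein; [exact: XY | exact: YX].
apply: Qeq_skein; apply: skein_eq_trans (vec_vecD d _ _ _) _.
rewrite addrK subrK; symmetry; exact: rotVQ_vec.
Qed.

(** The coordinates of (p, q, r) on (D, E, I) are p, q1 and r1; the inverse for
    the comultiplication is taken there and rotated back to (H, I, E). *)
Lemma beta_vec p q r a b c (q1 := r - k * p) (r1 := q + k * p) :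
    q1 != 0 -> q1 + p != 0 -> q1 + d * r1 != 0 ->
    a = - p / (q1 * (q1 + p)) -> b = q1^-1 -> c = - r1 / (q1 * (q1 + d * r1)) ->
  beta d (vec p q r) (vec a b c).
Proof.
move=> q0 qp0 qr0 -> -> ->.
exists (vecD (- p / (q1 * (q1 + p))) q1^-1
             (- r1 / (q1 * (q1 + d * r1)))).
have [XY YX] := op_table_inverse (@comulQ_bilinear C) (comulQ_table d) q0 qp0 qr0.
have eX := vec_vecD d p q r.
split; last by apply: Qeq_skein; symmetry; exact: rotQ_vecD.
split; apply: Qeq_skein; [apply: skein_eq_trans XY | apply: skein_eq_trans YX].
  exact: (comulQ_eq eX (skein_eq_refl d _)).
exact: (comulQ_eq (skein_eq_refl d _) eX).
Qed.

Lemma vecZ a p q r : a *: @vec C p q r = vec (a * p) (a * q) (a * r).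
Proof. exact: comb3Z. Qed.

Variables (w : C).
Hypotheses (w0 : w != 0) (d_w : d = w + w^-1 + 1) (d1 : d - 1 != 0).

Definition generic (z : C) : Prop := forall n : int, z <> w ^ n /\ z <> - w ^ n.

Lemma generic_neq z n : generic z ->
  [/\ z - w ^+ n != 0, z + w ^+ n != 0, w ^+ n * z - 1 != 0 &
      w ^+ n * z + 1 != 0].
Proof.
move=> gz; have [zn zNn] := gz n%:Z; have [zV zNV] := gz (- n%:Z).
have wn0 : w ^+ n != 0 by rewrite expf_neq0.
split; apply/eqP.
- by move/eqP; rewrite subr_eq0 => /eqP.
- by move/eqP; rewrite addr_eq0 => /eqP.
- move/eqP; rewrite subr_eq0 => /eqP wz; apply: zV.
  by apply: (mulfI wn0); rewrite wz -exprnN mulfV.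
- move/eqP; rewrite addr_eq0 => /eqP wz; apply: zNV.
  by apply: (mulfI wn0); rewrite wz -exprnN mulrN mulfV.
Qed.

Lemma generic_scale z (m : int) : generic z -> generic (z * w ^ m).
Proof.
move=> gz n; have [zn zNn] := gz (n - m); have wm : w ^ m != 0 by rewrite expfz_neq0.
have e : w ^ n = w ^ (n - m) * w ^ m by rewrite -expfzDr // subrK.
by split=> zw; [apply: zn | apply: zNn]; apply: (mulIf wm); rewrite zw e ?mulNr.
Qed.

Lemma generic_opp z : generic z -> generic (- z).
Proof.
move=> gz n; have [zn zNn] := gz n; split=> zw; last exact/zn/oppr_inj.
by apply: zNn; rewrite -zw opprK.
Qed.

Definition alpha_factor (z : C) : C :=
  w ^+ 2 * (z + w ^+ 2) * (z - w ^+ 3) / ((z - w ^+ 5) * (z + w ^+ 4)).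

Lemma w2_neq0 : w ^+ 2 + 1 != 0.
Proof.
have -> : w ^+ 2 + 1 = w * (d - 1) by rewrite d_w; field.
by rewrite mulf_neq0.
Qed.

Lemma turn_coefE : k = w / (w ^+ 2 + 1).
Proof.
have -> : d - 1 = (w ^+ 2 + 1) / w by rewrite d_w; field.
by rewrite invf_div.
Qed.

(** The eigenvalues of A(z) other than 1 are - (z + w^4)/(w^2 (z + 1)) and
    (z - w^5)/(w^2 (w z - 1)), whence the two poles of the factor. *)
Lemma alpha_sol c z : c != 0 -> generic z ->
  alpha d (c *: solA w z) ((alpha_factor z / c) *: solA w (- z / w ^+ 3)).
Proof.
move=> c0 gz; rewrite /solA !vecZ.
have [_ z1 _ _] := generic_neq 0 gz; rewrite expr0 in z1.
have [_ _ wz _] := generic_neq 1 gz; rewrite expr1 in wz.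
have [_ z2 _ _] := generic_neq 2 gz.
have [z3 _ _ _] := generic_neq 3 gz.
have [_ z4 _ _] := generic_neq 4 gz.
have [z5 _ _ _] := generic_neq 5 gz.
have w2 := w2_neq0.
set p := c * (- _ / _); set r := c * (- _ / (w * (w * z - 1))).
have qp : c * 1 + p = - (c * (z + w ^+ 4) / (w ^+ 2 * (z + 1))).
  by rewrite /p; field; rewrite z1 w0.
have qr : c * 1 + d * r = c * (z - w ^+ 5) / (w ^+ 2 * (w * z - 1)).
  by rewrite /r d_w; field; rewrite wz w0.
have qp0 : c * 1 + p != 0.
  by rewrite qp oppr_eq0 !(mulf_neq0, invr_neq0, expf_neq0).
have qr0 : c * 1 + d * r != 0.
  by rewrite qr !(mulf_neq0, invr_neq0, expf_neq0).
have q0 : c * 1 != 0 by rewrite mulr1.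
have z'1 : - z / w ^+ 3 + 1 = - (z - w ^+ 3) / w ^+ 3 by field.
have wz' : w * (- z / w ^+ 3) - 1 = - (z + w ^+ 2) / w ^+ 2 by field.
apply: (alpha_vec q0 qp0 qr0);
  rewrite ?qp ?qr ?turn_coefE /p /r /alpha_factor ?z'1 ?wz'; field;
  by rewrite ?z1 ?w0 ?wz ?z2 ?z3 ?z4 ?z5 ?c0 ?w2.
Qed.

Definition beta_factor (z : C) : C :=
  w * (w * z - 1) * (z + 1) / ((z + w ^+ 2) * (z - w)).

(** The map undoes [alpha_sol], up to the scalar.  Its three eigenvalue conditions
    are the identities q1E, qp and qr. *)
Lemma beta_sol c z : c != 0 -> generic z ->
  beta d (c *: solA w z) ((beta_factor z / c) *: solA w (- z * w ^+ 3)).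
Proof.
move=> c0 gz; rewrite /solA !vecZ.
have [_ z0 _ _] := generic_neq 0 gz; rewrite expr0 in z0.
have [z1 _ wz _] := generic_neq 1 gz; rewrite expr1 in z1 wz.
have [_ z2 _ _] := generic_neq 2 gz.
have [_ _ w3z _] := generic_neq 3 gz.
have [_ _ _ w4z] := generic_neq 4 gz.
have w2 := w2_neq0.
set p := c * (- _ / _); set r := c * (- _ / (w * (w * z - 1))).
have q1E : r - k * p = c * ((z + w ^+ 2) * (z - w)) / (w * (z + 1) * (w * z - 1)).
  by rewrite turn_coefE /p /r; field; rewrite z0 w0 wz w2.
have r1E : c * 1 + k * p = c * ((w - 1) * (z - w)) / (w * (z + 1)).
  by rewrite turn_coefE /p; field; rewrite z0 w0 w2.
have qp : r - k * p + p =
    - (c * ((z + w ^+ 2) * (w ^+ 3 * z - 1)) / (w ^+ 2 * (z + 1) * (w * z - 1))).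
  by rewrite q1E /p; field; rewrite z0 w0 wz.
have qr : r - k * p + d * (c * 1 + k * p) =
    c * ((z - w) * (w ^+ 4 * z + 1)) / (w ^+ 2 * (z + 1) * (w * z - 1)).
  by rewrite q1E r1E d_w; field; rewrite z0 w0 wz.
have z'1 : - z * w ^+ 3 + 1 = - (w ^+ 3 * z - 1) by ring.
have wz' : w * (- z * w ^+ 3) - 1 = - (w ^+ 4 * z + 1) by ring.
apply: beta_vec; rewrite ?qp ?qr ?q1E ?r1E ?oppr_eq0.
- by rewrite !(mulf_neq0, invr_neq0, expf_neq0).
- by rewrite !(mulf_neq0, invr_neq0, expf_neq0).
- by rewrite !(mulf_neq0, invr_neq0, expf_neq0).
all: rewrite /p /beta_factor ?z'1 ?wz'; field;
  by rewrite ?z0 ?w0 ?wz ?z1 ?z2 ?w3z ?w4z ?c0 ?w2.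
Qed.

Lemma alpha_factor_neq0 z : generic z -> alpha_factor z != 0.
Proof.
move=> gz; have [_ z2 _ _] := generic_neq 2 gz; have [z3 _ _ _] := generic_neq 3 gz.
have [_ z4 _ _] := generic_neq 4 gz; have [z5 _ _ _] := generic_neq 5 gz.
by rewrite !(mulf_neq0, invr_neq0, expf_neq0).
Qed.

Lemma beta_factor_neq0 z : generic z -> beta_factor z != 0.
Proof.
move=> gz; have [_ z0 _ _] := generic_neq 0 gz; rewrite expr0 in z0.
have [z1 _ wz _] := generic_neq 1 gz; rewrite expr1 in z1 wz.
have [_ z2 _ _] := generic_neq 2 gz.
by rewrite !(mulf_neq0, invr_neq0, expf_neq0).
Qed.

(** The scalar has to be carried along the induction, because each step inverts
    it. *)
Lemma iter_sol (f : comb 2 2 -> comb 2 2 -> Prop) (factor next : C -> C) m c z :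
    (forall c z, c != 0 -> generic z ->
       f (c *: solA w z) ((factor z / c) *: solA w (next z))) ->
    (forall z, generic z -> factor z != 0 /\ generic (next z)) ->
    c != 0 -> generic z ->
  exists Y, iter_rel d f m (c *: solA w z) Y.
Proof.
move=> f_sol f_gen; elim: m c z => [|m IHm] c z c0 gz.
  by exists (c *: solA w z); apply: Qeq_skein; exact: skein_eq_refl.
have [s0 gz'] := f_gen z gz; have c'0 : factor z / c != 0.
  by rewrite mulf_neq0 ?invr_neq0.
have [Y XY] := IHm _ _ c'0 gz'; exists Y.
by exists ((factor z / c) *: solA w (next z)) => //; exact: f_sol.
Qed.

Lemma in_dom_sol n c z : c != 0 -> generic z -> in_dom_alpha_pow d n (c *: solA w z).
Proof.
move=> c0 gz; case: n => m.
  apply: (iter_sol m (factor := alpha_factor) (next := fun z => - z / w ^+ 3)) c0 gz.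
    exact: alpha_sol.
  move=> {}z gz; split; first exact: alpha_factor_neq0.
  exact: (@generic_scale _ (- 3) (generic_opp gz)).
apply: (iter_sol m.+1 (factor := beta_factor) (next := fun z => - z * w ^+ 3)) c0 gz.
  exact: beta_sol.
move=> {}z gz; split; first exact: beta_factor_neq0.
exact: (@generic_scale _ 3 (generic_opp gz)).
Qed.
End Orbit.

(** * The ABC equation in coordinates *)

Section Pentagon.
Variables (C : numClosedFieldType) (d : C).
Local Notation comb := (@comb C).
Local Notation "X =~ Y" := (skein_eq d X Y) (at level 70, no associativity).
Local Notation k := (d - 1)^-1.
Local Notation H := (gH C).
Local Notation I := (gI C).
Local Notation E := (gE C).
Local Notation D := (gD C).

Lemma diagD_eq (X X' Y Y' : comb 2 2) : X =~ X' -> Y =~ Y' -> diagD X Y =~ diagD X' Y'.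
Proof.
move=> eX /(@strand_beside_eq _ _ _ _) eY.
have eX2 := skein_eq_beside eX (skein_eq_refl d (ids C 2)).
exact: (skein_eq_stack (skein_eq_stack (skein_eq_stack (skein_eq_refl d _) eX2) eY)
          (skein_eq_refl d _)).
Qed.

Lemma diagY_eq (X X' : comb 2 2) : X =~ X' -> diagY X =~ diagY X'.
Proof.
move=> eX; have eX1 := skein_eq_beside eX (skein_eq_refl d (ids C 1)).
exact: (skein_eq_stack (skein_eq_stack eX1 (skein_eq_refl d _)) (skein_eq_refl d _)).
Qed.

Lemma diagT_eq (X X' : comb 2 2) : X =~ X' -> diagT X =~ diagT X'.
Proof.
move=> /strand_beside_eq eX.
exact: (skein_eq_stack (skein_eq_stack (skein_eq_refl d _) eX) (skein_eq_refl d _)).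
Qed.

Definition comb6 (V : lmodType C) (x1 x2 x3 x4 x5 x6 : V) a1 a2 a3 a4 a5 a6 : V :=
  comb3 x1 x2 x3 a1 a2 a3 + comb3 x4 x5 x6 a4 a5 a6.

Section Comb6.
Variables (V : lmodType C) (x1 x2 x3 x4 x5 x6 : V).
Local Notation K := (comb6 x1 x2 x3 x4 x5 x6).

Lemma comb6D a1 a2 a3 a4 a5 a6 b1 b2 b3 b4 b5 b6 :
  K a1 a2 a3 a4 a5 a6 + K b1 b2 b3 b4 b5 b6 =
  K (a1 + b1) (a2 + b2) (a3 + b3) (a4 + b4) (a5 + b5) (a6 + b6).
Proof. by rewrite /comb6 [LHS]addrACA !comb3D. Qed.

Lemma comb6Z a a1 a2 a3 a4 a5 a6 :
  a *: K a1 a2 a3 a4 a5 a6 = K (a * a1) (a * a2) (a * a3) (a * a4) (a * a5) (a * a6).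
Proof. by rewrite /comb6 [LHS]scalerDr !comb3Z. Qed.

Lemma comb3_comb6 a1 a2 a3 a4 a5 a6 b1 b2 b3 b4 b5 b6 c1 c2 c3 c4 c5 c6 p q r :
  comb3 (K a1 a2 a3 a4 a5 a6) (K b1 b2 b3 b4 b5 b6) (K c1 c2 c3 c4 c5 c6) p q r =
  K (p * a1 + q * b1 + r * c1) (p * a2 + q * b2 + r * c2) (p * a3 + q * b3 + r * c3)
    (p * a4 + q * b4 + r * c4) (p * a5 + q * b5 + r * c5) (p * a6 + q * b6 + r * c6).
Proof. by rewrite [LHS]/(comb3 _ _ _ _ _ _) !comb6Z !comb6D. Qed.

Lemma comb6_basis :
  [/\ x1 = K 1 0 0 0 0 0, x2 = K 0 1 0 0 0 0, x3 = K 0 0 1 0 0 0 &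
   [/\ x4 = K 0 0 0 1 0 0, x5 = K 0 0 0 0 1 0, x6 = K 0 0 0 0 0 1
     & 0 = K 0 0 0 0 0 0]].
Proof. by rewrite /comb6 /comb3 !scale1r !scale0r !addr0 !add0r. Qed.
End Comb6.

(** The spanning family of Q_5 in which both sides of the ABC equation are written: the
    tree Y(H), in which the left point is isolated, and the five pictures with
    one arc and one vertex, named by the labels that produce them. *)
Definition penta (a1 a2 a3 a4 a5 a6 : C) : comb 3 2 :=
  comb6 (diagY H) (diagD I I) (diagD E E) (diagD I E) (diagY E) (diagY I)
        a1 a2 a3 a4 a5 a6.

(** Takes the target coefficients as free variables, so that each use ends with
    six ring identities in whatever form is convenient. *)
Lemma comb3_penta (X Y Z : comb 3 2) a1 a2 a3 a4 a5 a6 b1 b2 b3 b4 b5 b6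
    c1 c2 c3 c4 c5 c6 p q r t1 t2 t3 t4 t5 t6 :
    X =~ penta a1 a2 a3 a4 a5 a6 -> Y =~ penta b1 b2 b3 b4 b5 b6 ->
    Z =~ penta c1 c2 c3 c4 c5 c6 ->
    t1 = p * a1 + q * b1 + r * c1 -> t2 = p * a2 + q * b2 + r * c2 ->
    t3 = p * a3 + q * b3 + r * c3 -> t4 = p * a4 + q * b4 + r * c4 ->
    t5 = p * a5 + q * b5 + r * c5 -> t6 = p * a6 + q * b6 + r * c6 ->
  comb3 X Y Z p q r =~ penta t1 t2 t3 t4 t5 t6.
Proof.
move=> eX eY eZ -> -> -> -> -> ->; apply: skein_eq_trans (comb3_eq p q r eX eY eZ) _.
rewrite /penta comb3_comb6; exact: skein_eq_refl.
Qed.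

Lemma penta_basis :
  [/\ diagY H =~ penta 1 0 0 0 0 0, diagD I I =~ penta 0 1 0 0 0 0,
      diagD E E =~ penta 0 0 1 0 0 0, diagD I E =~ penta 0 0 0 1 0 0 &
      [/\ diagY E =~ penta 0 0 0 0 1 0, diagY I =~ penta 0 0 0 0 0 1 &
       0 =~ penta 0 0 0 0 0 0]].
Proof.
have eq_eqv (X Y : comb 3 2) : X = Y -> X =~ Y by move=> ->; exact: skein_eq_refl.
have [b1 b2 b3 [b4 b5 b6 b0]] :=
  comb6_basis (diagY H) (diagD I I) (diagD E E) (diagD I E) (diagY E) (diagY I).
split; last split; apply: eq_eqv;
  [exact: b1|exact: b2|exact: b3|exact: b4|exact: b5|exact: b6|exact: b0].
Qed.

Lemma diagY_D_penta : diagY D =~ penta 1 0 0 0 k (- k).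
Proof.
have [T1 _ _ _ [YE YI _]] := penta_basis.
apply: skein_eq_trans (diagY_eq (gD_turn d)) _.
rewrite (comb3_linear _ _ _ _ _ _ (@diagY_linear C)).
by apply: (comb3_penta T1 YE YI); ring.
Qed.

Lemma skein_eq_eq m n (X Y : comb m n) : X = Y -> X =~ Y.
Proof. by move=> ->; exact: skein_eq_refl. Qed.

(** The relation between D and H, inserted in the left or the right disc. *)
Lemma diagD_turnl Y :
  diagD H Y =~ comb3 (diagD D Y) (diagD E Y) (diagD I Y) 1 (- k) k.
Proof.
have [linD _] := @diagD_bilinear C.
apply: skein_eq_trans (diagD_eq (gH_turn d) (skein_eq_refl d Y)) _.
exact: skein_eq_eq (comb3_linear D E I 1 (- k) k (linD Y)).
Qed.

Lemma diagD_turnr X :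
  diagD X H =~ comb3 (diagD X D) (diagD X E) (diagD X I) 1 (- k) k.
Proof.
have [_ linD] := @diagD_bilinear C.
apply: skein_eq_trans (diagD_eq (skein_eq_refl d X) (gH_turn d)) _.
exact: skein_eq_eq (comb3_linear D E I 1 (- k) k (linD X)).
Qed.

Lemma diagD_HE_penta : diagD H E =~ penta 1 0 (- k) k 0 0.
Proof.
have [T1 _ EE IE _] := penta_basis.
apply: skein_eq_trans (diagD_turnl E) _.
by apply: (comb3_penta (skein_eq_trans (diagD_DE d) T1) EE IE); ring.
Qed.

Lemma diagD_EH_penta : diagD E H =~ penta 0 0 (1 - k) 0 0 0.
Proof.
have [_ _ EE _ [_ _ z0]] := penta_basis.
apply: skein_eq_trans (diagD_turnr E) _.
by apply: (comb3_penta (skein_eq_trans (diagD_ED d) EE) EE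
             (skein_eq_trans (diagD_EI d) z0)); ring.
Qed.

Lemma diagT_D_penta : diagT D =~ penta 1 (- k) (- k) k k 0.
Proof.
have [_ II _ _ [YE _ _]] := penta_basis.
apply: skein_eq_trans (diagT_eq (gD_turn d)) _.
apply: skein_eq_trans (skein_eq_eq (comb3_linear H E I 1 k (- k) (@diagT_linear C))) _.
by apply: (comb3_penta (skein_eq_trans (diagT_H d) diagD_HE_penta)
  (skein_eq_trans (diagT_E d) YE) (skein_eq_trans (diagT_I d) II)); ring.
Qed.

(** A triangle is 1 - k times a vertex: when H is turned into D, the stacks D D
    and E D are D, while I D contains a lollipop. *)
Lemma comulQ_HD : comulQ H D =~ comb3 D D 0 1 (- k) k.
Proof.
have [lin_co _] := @comulQ_bilinear C; have [hh _ _ _ _ _ _ _ _] := comulQ_table d.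
have [_ _ ih _ _ _ _ eh _] := comulQ_table d.
apply: skein_eq_trans (comulQ_eq (gH_turn d) (skein_eq_refl d D)) _.
apply: skein_eq_trans (skein_eq_eq (comb3_linear D E I 1 (- k) k (lin_co D))) _.
exact: comb3_eq hh ih eh.
Qed.

Lemma diagD_HD_penta : diagD H D =~
  penta (1 - k) (- k * (1 - k)) (- k * (1 - k)) (k * (1 - k)) (k * (1 - k)) 0.
Proof.
have [_ _ _ _ [_ _ z0]] := penta_basis.
have [T0 _ _ _] := linear_morphisms (@diagT_linear C).
apply: skein_eq_trans (diagD_HD d) _; apply: skein_eq_trans (diagT_eq comulQ_HD) _.
apply: skein_eq_trans (skein_eq_eq (comb3_linear D D 0 1 (- k) k (@diagT_linear C))) _.
by apply: (comb3_penta diagT_D_penta diagT_D_penta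
             (skein_eq_trans (skein_eq_eq T0) z0)); ring.
Qed.

Lemma diagD_HI_penta : diagD H I =~ penta 0 1 0 0 0 0.
Proof. by have [_ II _ _ _] := penta_basis; apply: skein_eq_trans (diagD_HI d) II. Qed.

(** The square face is opened by turning the H in the right disc into a D, which
    leaves a triangle, a tree and an arc. *)
Lemma diagD_HH_penta : diagD H H =~
  penta (1 - k - k) (k - k * (1 - k)) (k * k - k * (1 - k))
        (k * (1 - k) - k * k) (k * (1 - k)) 0.
Proof.
apply: skein_eq_trans (diagD_turnr H) _.
by apply: (comb3_penta diagD_HD_penta diagD_HE_penta diagD_HI_penta); ring.
Qed.

Lemma diagD_vec p q r p' q' r' : diagD (vec p q r) (vec p' q' r') =~
  penta (p * p' * (1 - k - k) + p * r' + q * p')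
        (p * p' * (k - k * (1 - k)) + p * q' + q * q')
        (p * p' * (k * k - k * (1 - k)) - p * r' * k + r * p' * (1 - k) + r * r')
        (p * p' * (k * (1 - k) - k * k) + p * r' * k + q * r')
        (p * p' * (k * (1 - k)) + q * p' * k)
        (- (q * p' * k)).
Proof.
have [T1 II EE IE [YE YI z0]] := penta_basis.
have lin := comb3_bilinear H I E p q r p' q' r' (@diagD_bilinear C).
apply: skein_eq_trans (skein_eq_eq lin) _.
have eH := comb3_penta (p := p') (q := q') (r := r') diagD_HH_penta
  diagD_HI_penta diagD_HE_penta erefl erefl erefl erefl erefl erefl.
have eI := comb3_penta (p := p') (q := q') (r := r')
  (skein_eq_trans (diagD_IH d) diagY_D_penta) II IE
  erefl erefl erefl erefl erefl erefl.
have eE := comb3_penta (p := p') (q := q') (r := r') diagD_EH_penta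
  (skein_eq_trans (diagD_EI d) z0) EE erefl erefl erefl erefl erefl erefl.
by apply: (comb3_penta eH eI eE); ring.
Qed.

Lemma diagY_vec p q r : diagY (vec p q r) =~ penta p 0 0 0 r q.
Proof.
have [T1 _ _ _ [YE YI _]] := penta_basis.
apply: skein_eq_trans (skein_eq_eq (comb3_linear H I E p q r (@diagY_linear C))) _.
by apply: (comb3_penta T1 YI YE); ring.
Qed.

(** The second, third and fourth coefficients must vanish because Y(C) involves
    only a tree and the arcs that join the bottom point to one of its
    neighbours. *)
Lemma ABC_vec p q r p' q' r' p'' q'' r'' :
    p'' = p * p' * (1 - k - k) + p * r' + q * p' ->
    0 = p * p' * (k - k * (1 - k)) + p * q' + q * q' ->
    0 = p * p' * (k * k - k * (1 - k)) - p * r' * k + r * p' * (1 - k) + r * r' ->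
    0 = p * p' * (k * (1 - k) - k * k) + p * r' * k + q * r' ->
    r'' = p * p' * (k * (1 - k)) + q * p' * k ->
    q'' = - (q * p' * k) ->
  ABC_equation d (vec p q r) (vec p' q' r') (vec p'' q'' r'').
Proof.
move=> e1 e2 e3 e4 e5 e6; apply: Qeq_skein.
apply: skein_eq_trans (diagD_vec p q r p' q' r') _; symmetry.
by rewrite -e1 -e2 -e3 -e4 -e5 -e6; exact: diagY_vec.
Qed.
End Pentagon.

(** * The one-parameter solution *)

Section Scaling.
Variables (C : numClosedFieldType) (d w : C).
Hypotheses (w0 : w != 0) (d_w : d = w + w^-1 + 1) (d1 : d - 1 != 0).

Lemma ABC_sol z : generic w z -> ABC_equation d (solA w z) (solB w z) (solC w z).
Proof.
move=> gz; have [_ z0 _ _] := generic_neq w0 0 gz; rewrite expr0 in z0.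
have [z1 _ wz _] := generic_neq w0 1 gz; rewrite expr1 in z1 wz.
have [_ z2 _ _] := generic_neq w0 2 gz.
have w2 := w2_neq0 w0 d_w d1.
rewrite /solC vecZ.
have zB : z / w ^+ 2 + 1 = (z + w ^+ 2) / w ^+ 2 by field.
have wzB : w * (z / w ^+ 2) - 1 = (z - w) / w by field.
have zC : - z / w + 1 = - (z - w) / w by field.
have wzC : w * (- z / w) - 1 = - (z + 1) by field.
apply: ABC_vec; rewrite ?(turn_coefE w0 d_w) ?zB ?wzB ?zC ?wzC; field;
  by rewrite ?z0 ?z1 ?z2 ?w0 ?wz ?w2.
Qed.

Lemma scales_sol z : generic w z -> scales d (solA w z) (solB w z) (solC w z).
Proof.
move=> gz; split=> [|n]; first exact: ABC_sol.
have dom := in_dom_sol w0 d_w d1 n.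
split.
- by rewrite -[solA w z]scale1r; apply: dom => //; exact: oner_neq0.
- rewrite -[solB w z]scale1r; apply: dom; first exact: oner_neq0.
  exact: (generic_scale w0 (- 2) gz).
apply: dom; last exact: (generic_scale w0 (- 1) (generic_opp gz)).
have [_ z2 _ _] := generic_neq w0 2 gz; have [_ z4 _ _] := generic_neq w0 4 gz.
by rewrite !(mulf_neq0, invr_neq0).
Qed.
End Scaling.

(** Doubling the angle gives d = 1 + 2 cos(2 pi/n), and 2 pi/n < pi/2. *)
Lemma allowed_parameter_gt1 (R : realType) (d : R) : allowed_parameter d -> 1 < d.
Proof.
case=> [[n [n6 ->]]|d3]; last by apply: lt_le_trans d3; rewrite ltr1n.
have cos2 : cos (pi / n%:R *+ 2) = cos (pi / n%:R) ^+ 2 *+ 2 - 1 :> R by rewrite cos_mulr2n.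
have : 0 < cos (pi / n%:R *+ 2) :> R.
  have n0 : (0 : R) < n%:R by rewrite ltr0n; apply: leq_trans n6.
  have pn : 0 < pi / n%:R *+ 2 :> R by rewrite mulrn_wgt0 // divr_gt0 // pi_gt0.
  apply: cos_gt0_pihalf; rewrite (lt_trans _ pn) ?oppr_lt0 ?divr_gt0 ?pi_gt0 //=.
  rewrite -mulr_natr mulrAC ltr_pdivrMr // mulrAC ltr_pdivlMr // -mulrA.
  rewrite ltr_pM2l ?pi_gt0 // -!natrM ltr_nat; exact: leq_trans n6.
rewrite cos2 -mulr_natl; lra.
Qed.

Theorem theorem2p24 (R : realType) (d : R)
  (d_allowed : allowed_parameter d) (d_neq3 : d <> 3)
  (w : R[i]) (w_neq0 : w <> 0) (d_w : d%:C%C = w + w^-1 + 1)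
  (z : R[i]) (z_generic : forall n : int, z <> w ^ n /\ z <> - w ^ n) :
  scales d%:C%C (solA w z) (solB w z) (solC w z).
Proof.
have w0 : w != 0 by exact/eqP.
apply: (scales_sol w0 d_w) => //.
rewrite -(rmorph1 (real_complex R)) -rmorphB fmorph_eq0 subr_eq0.
by rewrite gt_eqF // allowed_parameter_gt1.
Qed.
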